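(* The subset $\mathrm{Sch}^{\mathrm{strong}}\subset\mathrm{Sch}$ of $\sigma$-isomorphism classes of strong Schur $\sigma$-groups is a countable intersection of open subsets of $\mathrm{Sch}$ and has measure $\mu_\infty(\mathrm{Sch}^{\mathrm{strong}})=1$.
   Context: Fix a prime $p>2$ and a group $\{1,\sigma\}$ of order $2$. All homomorphisms of pro-$p$-groups are continuous, all subgroups are closed, and ''generated'' means topologically generated. A $\sigma$-pro-$p$-group is a pro-$p$-group $G$ with a continuous action of $\{1,\sigma\}$, written $a\mapsto{}^\sigma a$; $\sigma$-homomorphisms and $\sigma$-isomorphisms are the $\sigma$-equivariant ones. Put $G^-:=\{a\in G\mid {}^\sigma a=a^{-1}\}$. Let $D_i(G)$ ($i\ge1$) be the Zassenhaus filtration (dimension subgroups mod $p$): $D_1(G)=G$, and $D_i(G)$ is generated by the $p$-th powers of elements of $D_{\lceil i/p\rceil}(G)$ and all $[D_j(G),D_k(G)]$ with $j+k=i$. $F_n$ is the free pro-$p$-group on $x_1,\dots,x_n$, made a $\sigma$-pro-$p$-group by ${}^\sigma x_i=x_i^{-1}$. For $r=(r_1,\dots,r_n)\in(F_n^-)^n$ let $N_r$ be the normal subgroup of $F_n$ generated by all conjugates of $r_1,\dots,r_n$, and $G_r:=F_n/N_r$. A weak Schur $\sigma$-group is a $\sigma$-pro-$p$-group $\sigma$-isomorphic to some $G_r$ with $n\ge0$, $r\in(F_n^-)^n$. A strong Schur $\sigma$-group is a weak Schur $\sigma$-group $G$ such that every open subgroup $H<G$ (including $H=G$) has finite abelianization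 $H_{\mathrm{ab}}=H/[H,H]$. $\mathrm{Sch}$ is the set of $\sigma$-isomorphism classes $[G]$ of weak Schur $\sigma$-groups, with the topology having as basis the sets $U_{i,G}:=\{[H]\in\mathrm{Sch}\mid H/D_i(H)\cong G/D_i(G)\ \sigma\text{-isomorphic}\}$ for all $i\ge2$ and all weak Schur $\sigma$-groups $G$. The Haar measure on $F_n^-$ is the unique Borel probability measure such that for every $\sigma$-invariant open normal subgroup $N\triangleleft F_n$ every fiber of the (surjective) map $F_n^-\to(F_n/N)^-$ has measure $1/|(F_n/N)^-|$. Let $\tilde\mu_n$ be the product measure on $(F_n^-)^n$, and $\mu_n$ its pushforward under the continuous map $(F_n^-)^n\to\mathrm{Sch}$, $r\mapsto[G_r]$. The probability measure $\mu_\infty$ on $\mathrm{Sch}$ is the limit $\mu_\infty(A)=\lim_{n\to\infty}\mu_n(A)$ for all Borel $A\subset\mathrm{Sch}$ (which exists). *)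

(* Defs.v *)
From HB Require Import structures.
From mathcomp Require Import all_boot all_order all_algebra.
From mathcomp Require Import finmap zify.
From mathcomp Require Import all_classical all_reals all_analysis.

Set Implicit Arguments.
Unset Strict Implicit.
Unset Printing Implicit Defensive.


Local Open Scope classical_set_scope.
Local Open Scope group_scope.
Local Open Scope quotient_scope.

HB.mixin Record isTopGroup G of Group G & Topological G := {
  mulg_continuous : continuous (fun z : G * G => z.1 * z.2);
  invg_continuous : continuous (fun x : G => x^-1)
}.

#[short(type="topGroupType")]
HB.structure Definition TopGroup :=
  {G of Group G & Topological G & isTopGroup G}.

HB.mixin Record hasSigma G of TopGroup G := {
  sigma : G -> G;
  sigmaM : {morph sigma : x y / x * y};
  sigmaK : involutive sigma;
  sigma_continuous : continuous sigma
}.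

#[short(type="sigmaGroupType")]
HB.structure Definition SigmaGroup := {G of TopGroup G & hasSigma G}.

Section Subgroups.
Variable G : topGroupType.
Implicit Types A B H N : set G.

Definition is_subgroup H :=
  [/\ H 1, (forall x y, H x -> H y -> H (x * y)) & (forall x, H x -> H x^-1)].

Definition is_normal N := is_subgroup N /\ (forall x g, N x -> N (x ^ g)).

Definition cosets H N : set (set G) :=
  [set C | exists2 x, H x & C = [set x * y | y in N]].

(* topologically generated subgroup *)
Definition cgen A : set G :=
  \bigcap_(H in [set H | [/\ closed H, is_subgroup H & A `<=` H]]) H.

Definition comm_subgroup A B : set G :=
  cgen [set z | exists x y, [/\ A x, B y & z = [~ x, y]]].

Definition finite_abelianization H := finite_set (cosets H (comm_subgroup H H)).

Lemma cgen_sub A : A `<=` cgen A.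
Proof. by move=> x Ax H [_ _]; apply. Qed.

Lemma cgen_closed A : closed (cgen A).
Proof. by apply: closed_bigI => H []. Qed.

Lemma cgen_subgroup A : is_subgroup (cgen A).
Proof.
split=> [H [_ [] //]|x y Ax Ay H HA|x Ax H HA].
  by case: (HA) => _ [_ HM _] _; apply: HM; [exact: Ax|exact: Ay].
by case: (HA) => _ [_ _ HV] _; apply: HV; exact: Ax.
Qed.

Lemma cgen_min A H : closed H -> is_subgroup H -> A `<=` H -> cgen A `<=` H.
Proof. by move=> cH sH AH x; apply. Qed.

End Subgroups.

(* pro-p: compact, Hausdorff, and the open normal subgroups of p-power index
   form a fundamental system of neighbourhoods of 1 *)
Definition pro_group (p : nat) (G : topGroupType) :=
  [/\ compact [set: G], hausdorff_space G &
      forall U : set G, nbhs 1 U -> exists N : set G,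
        [/\ open N, is_normal N, N `<=` U &
            exists k, (cosets [set: G] N #= `I_(p ^ k))%card]].

Lemma preimage_subgroup (G K : topGroupType) (f : G -> K) (H : set K) :
  {morph f : x y / x * y} -> is_subgroup H -> is_subgroup (f @^-1` H).
Proof.
move=> fM [H1 HM HV].
have f1 : f 1 = 1 by apply: (@mulIg _ (f 1)); rewrite -fM !mul1g.
have fV x : f x^-1 = (f x)^-1.
  by apply: (@mulIg _ (f x)); rewrite -fM !mulVg.
split=> /= [|x y Hx Hy|x Hx]; rewrite ?f1 ?fM ?fV //; [exact: HM|exact: HV].
Qed.

Lemma cgen_morph (G K : topGroupType) (f : G -> K) (A : set G) (B : set K) :
  continuous f -> {morph f : x y / x * y} ->
  (forall x, A x -> cgen B (f x)) -> forall x, cgen A x -> cgen B (f x).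
Proof.
move=> fc fM fAB; apply: cgen_min; last exact: fAB.
  by apply: preimage_closed => //; exact: cgen_closed.
by apply: preimage_subgroup => //; exact: cgen_subgroup.
Qed.

Lemma mulg_cvg (G : topGroupType) (T : Type) (F : set_system T) {FF : Filter F}
    (f g : T -> G) (a b : G) :
  f @ F --> a -> g @ F --> b -> (fun t => f t * g t) @ F --> a * b.
Proof.
move=> fa gb.
have h : (fun t => (f t, g t)) @ F --> (a, b) by exact: cvg_pair.
exact: (cvg_comp _ _ h (@mulg_continuous G (a, b))).
Qed.

Lemma conjg_continuous (G : topGroupType) (g : G) :
  continuous (fun x : G => x ^ g).
Proof.
move=> x; apply: mulg_cvg; first exact: cvg_cst.
by apply: mulg_cvg; [exact: cvg_id|exact: cvg_cst].
Qed.

Section Zassenhaus.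
Variables (p : nat) (G : topGroupType).

(* (i + p.-1) %/ p is the ceiling of i / p; [f] is fuel for the recursion *)
Fixpoint zassenhaus_rec (f i : nat) : set G :=
  if f is f'.+1 then
    if (i <= 1)%N then setT else
    cgen ([set x ^+ p | x in zassenhaus_rec f' ((i + p.-1) %/ p)%N] `|`
          \bigcup_(j in [set j | (0 < j < i)%N])
            comm_subgroup (zassenhaus_rec f' j) (zassenhaus_rec f' (i - j)%N))
  else setT.

Definition zassenhaus (i : nat) : set G := zassenhaus_rec i i.

Lemma zassenhaus_rec_p1 f i : p = 1%N -> zassenhaus_rec f i = setT.
Proof.
move=> p1; elim: f i => //= f IH i; case: ifP => // _.
rewrite eqEsubset; split=> // x _; apply: cgen_sub; left.
by exists x; rewrite ?IH// p1 expg1.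
Qed.

Lemma ceil_lt i : p != 1%N -> (1 < i)%N -> ((i + p.-1) %/ p < i)%N.
Proof.
case: p => [|[|q]] //= _ i1; first by rewrite divn0 (ltn_trans _ i1).
by rewrite ltn_divLR//; nia.
Qed.

Let zassenhaus_rec_fuel f g i : (i <= f)%N -> (i <= g)%N ->
  zassenhaus_rec f i = zassenhaus_rec g i.
Proof.
have [p1|p1] := eqVneq p 1%N; first by rewrite !zassenhaus_rec_p1.
elim: f g i => [|f IH] [|g] i //=.
- by rewrite leqn0 => /eqP ->.
- by move=> _; rewrite leqn0 => /eqP ->.
move=> if_ ig; case: leqP => // i1.
have ci := ceil_lt p1 i1.
rewrite (IH g); [|lia..].
congr (cgen (_ `|` _)); apply: eq_bigcupr => j /= /andP[j0 ji].
by congr comm_subgroup; apply: IH; lia.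
Qed.

Lemma zassenhaus1 : zassenhaus 1 = setT. Proof. by []. Qed.

Lemma zassenhausE i : (1 < i)%N -> zassenhaus i =
  cgen ([set x ^+ p | x in zassenhaus ((i + p.-1) %/ p)%N] `|`
        \bigcup_(j in [set j | (0 < j < i)%N])
          comm_subgroup (zassenhaus j) (zassenhaus (i - j)%N)).
Proof.
move=> i1; have [p1|p1] := eqVneq p 1%N.
  rewrite /zassenhaus zassenhaus_rec_p1//; apply/esym.
  rewrite eqEsubset; split=> // x _; apply: cgen_sub; left.
  by exists x; rewrite ?zassenhaus_rec_p1// p1 expg1.
have ci := ceil_lt p1 i1; case: i i1 ci => // i i1 ci.
rewrite {1}/zassenhaus /= leqNgt i1 /=.
rewrite (@zassenhaus_rec_fuel i ((i.+1 + p.-1) %/ p)%N ((i.+1 + p.-1) %/ p)%N);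
  [|lia..].
congr (cgen (_ `|` _)); apply: eq_bigcupr => j /= /andP[j0 ji].
by congr comm_subgroup; apply: zassenhaus_rec_fuel; lia.
Qed.

Lemma zassenhaus_ind (P : nat -> Prop) :
  (forall i, (i <= 1)%N -> P i) ->
  (forall i, (1 < i)%N -> (forall j, (j < i)%N -> P j) -> P i) ->
  forall i, P i.
Proof.
move=> P1 Pi i; have [n] := ubnP i; elim: n i => // n IH i.
have [/P1//|i1 ni] := leqP i 1; apply: Pi => // j ji; apply: IH.
by lia.
Qed.

Lemma zassenhaus_small i : (i <= 1)%N -> zassenhaus i = setT.
Proof. by case: i => [|[]]. Qed.

Lemma zassenhaus_closed i : closed (zassenhaus i).
Proof.
have [/zassenhaus_small ->|i1] := leqP i 1; first exact: closedT.
by rewrite zassenhausE//; exact: cgen_closed.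
Qed.

Lemma zassenhaus_subgroup i : is_subgroup (zassenhaus i).
Proof.
have [/zassenhaus_small ->//|i1] := leqP i 1.
by rewrite zassenhausE//; exact: cgen_subgroup.
Qed.

End Zassenhaus.
Arguments zassenhaus_rec p G f i : clear implicits.
Arguments zassenhaus p G i : clear implicits.

Lemma gmorphV (G K : topGroupType) (f : G -> K) :
  {morph f : x y / x * y} -> {morph f : x / x^-1}.
Proof.
move=> fM x; have f1 : f 1 = 1.
  by apply: (@mulIg _ (f 1)); rewrite -fM !mul1g.
by apply: (@mulIg _ (f x)); rewrite -fM !mulVg.
Qed.

Lemma gmorphR (G K : topGroupType) (f : G -> K) :
  {morph f : x y / x * y} -> {morph f : x y / [~ x, y]}.
Proof. by move=> fM x y; rewrite /commg /conjg !fM !(gmorphV fM). Qed.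

Lemma gmorphX (G K : topGroupType) (f : G -> K) n :
  {morph f : x y / x * y} -> {morph f : x / x ^+ n}.
Proof.
move=> fM x; have f1 : f 1 = 1.
  by apply: (@mulIg _ (f 1)); rewrite -fM !mul1g.
by elim: n => [|n IH]; rewrite ?expg0// !expgS fM IH.
Qed.

Lemma zassenhaus_morph p (G K : topGroupType) (f : G -> K) i :
  continuous f -> {morph f : x y / x * y} ->
  forall x, zassenhaus p G i x -> zassenhaus p K i (f x).
Proof.
move=> fc fM; rewrite /zassenhaus; move: {1 3}i => n.
elim: n i => //= n IH i; case: ifP => // _.
apply: cgen_morph => // y [[x /IH fx <-]|[j /= ij xy]].
  by apply: cgen_sub; left; exists (f x) => //; rewrite -(gmorphX p fM).
suff: comm_subgroup (zassenhaus_rec p K n j) (zassenhaus_rec p K n (i - j)%N)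
    `<=` cgen ([set x ^+ p | x in zassenhaus_rec p K n ((i + p.-1) %/ p)%N] `|`
          \bigcup_(j in [set j | (0 < j < i)%N])
            comm_subgroup (zassenhaus_rec p K n j)
              (zassenhaus_rec p K n (i - j)%N)).
  apply; apply: cgen_morph xy => // _ [a [b [/IH fa /IH fb ->]]].
  by apply: cgen_sub; exists (f a), (f b); rewrite -(gmorphR fM).
by move=> z zj; apply: cgen_sub; right; exists j.
Qed.

Lemma zassenhaus_conj p (G : topGroupType) i (x g : G) :
  zassenhaus p G i x -> zassenhaus p G i (x ^ g).
Proof.
apply: (zassenhaus_morph (f := fun x => x ^ g)); first exact: conjg_continuous.
by move=> ? ?; rewrite conjMg.
Qed.

Lemma zassenhausS p (G : topGroupType) i :
  zassenhaus p G i.+1 `<=` zassenhaus p G i.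
Proof.
pose P i := zassenhaus p G i.+1 `<=` zassenhaus p G i.
apply: (zassenhaus_ind (P := P)) => {}i.
  by move=> i1; rewrite /P (zassenhaus_small _ _ i1).
move=> i1 IH; rewrite /P zassenhausE ?(ltn_trans i1)//.
apply: cgen_min; [exact: zassenhaus_closed|exact: zassenhaus_subgroup|].
move=> z [[x xD <-]|[j /= /andP[j0 ji]]].
  have [p1|p1] := eqVneq p 1%N.
    by rewrite /zassenhaus zassenhaus_rec_p1.
  rewrite zassenhausE//; apply: cgen_sub; left; exists x => //.
  have ci : ((i + p.-1) %/ p < i)%N by exact: ceil_lt.
  have [->//|ne] := eqVneq ((i + p.-1) %/ p)%N ((i.+1 + p.-1) %/ p)%N.
  suff E : ((i.+1 + p.-1) %/ p = ((i + p.-1) %/ p).+1)%N.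
    by apply: (IH _ ci); rewrite -E.
  have : ((i + p.-1) %/ p <= (i.+1 + p.-1) %/ p)%N.
    by rewrite leq_div2r// leq_add2r.
  have : ((i.+1 + p.-1) %/ p <= ((i + p.-1) %/ p).+1)%N.
    have [->|p0] := posnP p; first by rewrite !divn0.
    have -> : ((i + p.-1) %/ p).+1 = ((i + p.-1 + p) %/ p)%N.
      by rewrite [in RHS]divnDr// divnn p0 addn1.
    by rewrite leq_div2r//; lia.
  by lia.
apply: cgen_min; [exact: zassenhaus_closed|exact: zassenhaus_subgroup|].
move=> _ [a [b [aj bj ->]]]; have [j1|j1] := ltnP 1 j.
  rewrite zassenhausE//; apply: cgen_sub; right; exists j.-1 => /=; first lia.
  apply: cgen_sub; exists a, b; split=> //.
    by apply: (IH j.-1); [lia|rewrite prednK].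
  by rewrite (_ : i - j.-1 = i.+1 - j)%N//; lia.
have je : j = 1%N by lia.
move: bj; rewrite je subn1 /= => bi; rewrite commgEr.
have [_ iM iV] := zassenhaus_subgroup p G i.
by apply: iM => //; apply: zassenhaus_conj; exact: iV.
Qed.

Record sigmaNormal (G : sigmaGroupType) := SigmaNormal {
  nset :> set G;
  nset_normal : is_normal nset;
  nset_sigma : forall x, nset x -> nset (sigma x)
}.

Section Quotient.
Variables (G : sigmaGroupType) (N : sigmaNormal G).

Let N1 : nset N 1. Proof. by case: (nset_normal N) => -[]. Qed.
Let NM x y : nset N x -> nset N y -> nset N (x * y).
Proof. by case: (nset_normal N) => -[_ + _] _; apply. Qed.
Let NV x : nset N x -> nset N x^-1.
Proof. by case: (nset_normal N) => -[_ _ +] _; apply. Qed.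
Let NJ x g : nset N x -> nset N (x ^ g).
Proof. by case: (nset_normal N) => _; apply. Qed.

Definition coset_rel (x y : G) : bool := `[< nset N (x^-1 * y) >].

Lemma coset_rel_equiv : equiv_class_of coset_rel.
Proof.
split=> [x|x y|y x z].
- by apply/asboolP; rewrite mulVg.
- by apply/asboolP/asboolP => /NV; rewrite invgM invgK.
- by move=> /asboolP xy /asboolP yz; apply/asboolP;
    have := NM xy yz; rewrite mulgA mulgK.
Qed.

Canonical coset_equiv := EquivRelPack coset_rel_equiv.

Definition quot : Type := quotient_topology {eq_quot coset_equiv}.

HB.instance Definition _ := Topological.on quot.
HB.instance Definition _ := Quotient.on quot.

Definition quot_pi (x : G) : quot := \pi_quot x.

Lemma quot_piP x y : quot_pi x = quot_pi y <-> nset N (x^-1 * y).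
Proof.
rewrite -[quot_pi x = _]/(x = y %[mod {eq_quot coset_equiv}]).
by split=> [/eqmodP/asboolP|xy] //; apply/eqmodP/asboolP.
Qed.

Lemma quot_reprK (u : quot) : quot_pi (repr u) = u. Proof. exact: reprK. Qed.

Definition quot_mul (u v : quot) : quot := quot_pi (repr u * repr v).
Definition quot_inv (u : quot) : quot := quot_pi (repr u)^-1.
Definition quot_sigma (u : quot) : quot := quot_pi (sigma (repr u)).

Lemma quot_mulE x y : quot_mul (quot_pi x) (quot_pi y) = quot_pi (x * y).
Proof.
have /quot_piP xP := quot_reprK (quot_pi x).
have /quot_piP yP := quot_reprK (quot_pi y).
apply/quot_piP; have := NM (NJ (repr (quot_pi y)) xP) yP.
by rewrite /conjg !invgM !mulgA mulgK.
Qed.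

Lemma quot_invE x : quot_inv (quot_pi x) = quot_pi x^-1.
Proof.
have /quot_piP xP := quot_reprK (quot_pi x).
apply/quot_piP; have := NV (NJ (repr (quot_pi x))^-1 xP).
by rewrite /conjg invgK !invgM !invgK !mulgA mulgK.
Qed.

Lemma sigmaV (x : G) : sigma x^-1 = (sigma x)^-1.
Proof.
have s1 : sigma 1 = 1 :> G.
  by apply: (@mulIg _ (sigma 1)); rewrite -sigmaM !mul1g.
by apply: (@mulIg _ (sigma x)); rewrite -sigmaM !mulVg.
Qed.

Lemma quot_sigmaE x : quot_sigma (quot_pi x) = quot_pi (sigma x).
Proof.
have /quot_piP xP := quot_reprK (quot_pi x).
by apply/quot_piP; have := nset_sigma xP; rewrite sigmaM sigmaV.
Qed.

Lemma quot_ind (P : quot -> Prop) : (forall x, P (quot_pi x)) -> forall u, P u.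
Proof. by move=> PP u; rewrite -(quot_reprK u). Qed.

Fact quot_mulA : associative quot_mul.
Proof.
by do 3![elim/quot_ind => ?]; rewrite !quot_mulE mulgA.
Qed.

Fact quot_mul1 : left_id (quot_pi 1) quot_mul.
Proof. by elim/quot_ind => x; rewrite quot_mulE mul1g. Qed.

Fact quot_mulr1 : right_id (quot_pi 1) quot_mul.
Proof. by elim/quot_ind => x; rewrite quot_mulE mulg1. Qed.

Fact quot_mulV : left_inverse (quot_pi 1) quot_inv quot_mul.
Proof. by elim/quot_ind => x; rewrite quot_invE quot_mulE mulVg. Qed.

Fact quot_mulgV : right_inverse (quot_pi 1) quot_inv quot_mul.
Proof. by elim/quot_ind => x; rewrite quot_invE quot_mulE mulgV. Qed.

HB.instance Definition _ := isGroup.Build quot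
  quot_mulA quot_mul1 quot_mulr1 quot_mulV quot_mulgV.

Lemma quot_piM x y : quot_pi (x * y) = quot_pi x * quot_pi y.
Proof. by rewrite -quot_mulE. Qed.

Lemma quot_pi_continuous : continuous quot_pi.
Proof. exact: pi_continuous. Qed.

Lemma quot_openP (U : set quot) : open U <-> open (quot_pi @^-1` U).
Proof. by []. Qed.

Lemma quot_pi_open (U : set G) : open U -> open (quot_pi @` U).
Proof.
move=> oU; apply/quot_openP.
have -> : quot_pi @^-1` (quot_pi @` U) =
    \bigcup_(n in nset N) ((fun x => x * n) @^-1` U).
  rewrite eqEsubset; split=> x /= => [[y Uy /esym/quot_piP xy]|[n Nn] /= Uxn].
    by exists (x^-1 * y) => //=; rewrite mulgA mulgV mul1g.
  by exists (x * n) => //; apply/esym/quot_piP; rewrite mulgA mulVg mul1g.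
apply: bigcup_open => n _; apply: open_comp => // x _.
by apply: mulg_cvg; [exact: cvg_id|exact: cvg_cst].
Qed.

Lemma quot_pi_nbhs x (A : set G) : nbhs x A -> nbhs (quot_pi x) (quot_pi @` A).
Proof.
rewrite nbhsE => -[U [oU Ux] UA]; rewrite nbhsE.
by exists (quot_pi @` U); [split; [exact: quot_pi_open|exists x]|
  exact: image_subset].
Qed.

Fact quot_mul_continuous : continuous (fun z : quot * quot => z.1 * z.2).
Proof.
case=> u v; elim/quot_ind: u => x; elim/quot_ind: v => y W /=.
rewrite -quot_piM => /quot_pi_continuous /(@mulg_continuous G (x, y)).
case=> -[A B] /= [/quot_pi_nbhs xA /quot_pi_nbhs yB] AB.
exists (quot_pi @` A, quot_pi @` B) => //= -[_ _] /= [[a Aa <-] [b Bb <-]].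
by rewrite -quot_piM; exact: (AB (a, b)).
Qed.

Fact quot_inv_continuous : continuous (fun u : quot => u^-1).
Proof.
apply/quotient_continuous => x; rewrite /comp /=.
rewrite (_ : (fun _ => _) = quot_pi \o (fun z : G => z^-1)).
  by apply: continuous_comp; [exact: invg_continuous|exact: quot_pi_continuous].
by apply/funext => z; exact: quot_invE.
Qed.

HB.instance Definition _ :=
  isTopGroup.Build quot quot_mul_continuous quot_inv_continuous.

Fact quot_sigmaM : {morph quot_sigma : u v / u * v}.
Proof.
by do 2![elim/quot_ind => ?]; rewrite -quot_piM !quot_sigmaE sigmaM quot_piM.
Qed.

Fact quot_sigmaK : involutive quot_sigma.
Proof. by elim/quot_ind => x; rewrite !quot_sigmaE sigmaK. Qed.

Fact quot_sigma_continuous : continuous quot_sigma.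
Proof.
apply/quotient_continuous => x; rewrite /comp /=.
rewrite (_ : (fun _ => _) = quot_pi \o (@sigma G)).
  by apply: continuous_comp; [exact: sigma_continuous|exact: quot_pi_continuous].
by apply/funext => z; exact: quot_sigmaE.
Qed.

HB.instance Definition _ :=
  hasSigma.Build quot quot_sigmaM quot_sigmaK quot_sigma_continuous.

End Quotient.

Definition sigma_hom (G K : sigmaGroupType) (f : G -> K) :=
  [/\ continuous f, {morph f : x y / x * y} & {morph f : x / sigma x}].

Definition sigma_iso (G K : sigmaGroupType) :=
  exists (f : G -> K) (g : K -> G),
    [/\ sigma_hom f, sigma_hom g, cancel f g & cancel g f].

Lemma sigma_hom_comp (G K L : sigmaGroupType) (f : G -> K) (g : K -> L) :
  sigma_hom f -> sigma_hom g -> sigma_hom (g \o f).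
Proof.
move=> [fc fM fs] [gc gM gs]; split=> [x|x y|x] /=; rewrite ?fM ?gM ?fs ?gs//.
by apply: continuous_comp; [exact: fc|exact: gc].
Qed.

Lemma sigma_iso_refl G : sigma_iso G G.
Proof. by exists id, id; split=> //; split=> // x; exact: cvg_id. Qed.

Lemma sigma_iso_sym G K : sigma_iso G K -> sigma_iso K G.
Proof. by move=> [f [g [hf hg fg gf]]]; exists g, f. Qed.

Lemma sigma_iso_trans G K L : sigma_iso G K -> sigma_iso K L -> sigma_iso G L.
Proof.
move=> [f [g [hf hg fg gf]]] [f' [g' [hf' hg' fg' gf']]].
exists (f' \o f), (g \o g'); split; try exact: sigma_hom_comp.
  exact: can_comp.
exact: can_comp.
Qed.

Section QuotLift.
Variables (G K : sigmaGroupType) (N : sigmaNormal G) (f : G -> K).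
Hypotheses (fh : sigma_hom f) (fN : forall x, nset N x -> f x = 1).

Definition quot_lift (u : quot N) : K := f (repr u).

Lemma quot_liftE x : quot_lift (quot_pi N x) = f x.
Proof.
case: fh => _ fM _; have /quot_piP/fN := quot_reprK (quot_pi N x).
by rewrite fM (gmorphV fM) => /mulg1_eq; rewrite invgK.
Qed.

Lemma quot_lift_hom : sigma_hom quot_lift.
Proof.
case: fh => fc fM fs; split.
- apply/quotient_continuous; rewrite (_ : _ \o _ = f)//.
  by apply/funext => x; exact: quot_liftE.
- by do 2![elim/quot_ind => ?]; rewrite -quot_piM !quot_liftE fM.
- by elim/quot_ind => x; rewrite [sigma _]quot_sigmaE !quot_liftE fs.
Qed.

End QuotLift.

Lemma quot_pi_hom (G : sigmaGroupType) (N : sigmaNormal G) :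
  sigma_hom (quot_pi N).
Proof.
split; [exact: quot_pi_continuous|exact: quot_piM|move=> x].
by rewrite [RHS]quot_sigmaE.
Qed.

Section ZassenhausQuotient.
Variable p : nat.

Fact zassenhaus_normal (G : sigmaGroupType) i : is_normal (zassenhaus p G i).
Proof. by split=> [|x g]; [exact: zassenhaus_subgroup|exact: zassenhaus_conj]. Qed.

Fact zassenhaus_sigma (G : sigmaGroupType) i (x : G) :
  zassenhaus p G i x -> zassenhaus p G i (sigma x).
Proof.
apply: (zassenhaus_morph (f := @sigma G)).
  exact: sigma_continuous.
exact: sigmaM.
Qed.

Definition zassenhausN (G : sigmaGroupType) i :=
  SigmaNormal (@zassenhaus_normal G i) (@zassenhaus_sigma G i).

Definition zquot (G : sigmaGroupType) (i : nat) : sigmaGroupType :=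
  quot (zassenhausN G i).

Lemma zassenhaus_le (G : sigmaGroupType) i j : (i <= j)%N ->
  zassenhaus p G j `<=` zassenhaus p G i.
Proof.
move=> /subnK <-; elim: (j - i)%N => // n IH.
exact: subset_trans (@zassenhausS _ _ _) IH.
Qed.

Let pi (G : sigmaGroupType) j : G -> zquot G j := quot_pi (zassenhausN G j).

Lemma zquot_zassenhaus (G : sigmaGroupType) i j : (i <= j)%N ->
  zassenhaus p (zquot G j) i `<=` @pi G j @` zassenhaus p G i.
Proof.
move: i; apply: zassenhaus_ind => i i1.
  by move=> _ u _; exists (repr u); [rewrite zassenhaus_small|exact: quot_reprK].
move=> IH ij; rewrite zassenhausE//.
have [D1 DM DV] := zassenhaus_subgroup p G i.
have preim : @pi G j @^-1` (@pi G j @` zassenhaus p G i) = zassenhaus p G i.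
  rewrite eqEsubset; split=> x /=; last by exists x.
  move=> [y Dy /quot_piP yx]; rewrite -(mulVKg y x).
  by apply: DM => //; exact: zassenhaus_le yx.
have piM := @quot_piM G (zassenhausN G j).
have SC : closed (@pi G j @` zassenhaus p G i).
  rewrite -[X in closed X]setCK; apply: open_closedC; apply/quot_openP.
  change (open (~` (@pi G j @^-1` (@pi G j @` zassenhaus p G i)))).
  by rewrite preim; apply: closed_openC; exact: zassenhaus_closed.
have SS : is_subgroup (@pi G j @` zassenhaus p G i).
  split.
  + by exists 1.
  + by move=> _ _ [a Da <-] [b Db <-]; exists (a * b); [exact: DM|exact: piM].
  + move=> _ [a Da <-]; exists a^-1; [exact: DV|].
    exact: (gmorphV (f := @pi G j)).
apply: cgen_min => //.
move=> u [[v vD <-]|[k /= /andP[k0 ki]]].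
  have [p1|p1] := eqVneq p 1%N.
    exists (repr (v ^+ p)); last exact: quot_reprK.
    by rewrite /zassenhaus zassenhaus_rec_p1.
  have ci : ((i + p.-1) %/ p < i)%N by exact: ceil_lt.
  have [|x xD <-] := IH _ ci _ _ vD; first by rewrite (leq_trans _ ij)// ltnW.
  exists (x ^+ p); last exact: (gmorphX (f := @pi G j)).
  by rewrite zassenhausE//; apply: cgen_sub; left; exists x.
move: u; apply: cgen_min => // _ [u [v [uD vD ->]]].
have [|x xD <-] := IH _ ki _ _ uD; first by rewrite (leq_trans _ ij)// ltnW.
have [||y yD <-] := IH (i - k)%N _ _ _ vD; [by lia|by lia|].
exists [~ x, y]; last exact: (gmorphR (f := @pi G j)).
rewrite zassenhausE//; apply: cgen_sub; right; exists k; first exact/andP.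
by apply: cgen_sub; exists x, y.
Qed.

Lemma zquot_pi_zassenhaus (G : sigmaGroupType) i j x : (i <= j)%N ->
  zassenhaus p (zquot G j) i (@pi G j x) -> zassenhaus p G i x.
Proof.
move=> ij /(zquot_zassenhaus ij)[y Dy /quot_piP yx]; rewrite -(mulVKg y x).
have [_ DM _] := zassenhaus_subgroup p G i.
by apply: DM => //; exact: zassenhaus_le yx.
Qed.

Section Descend.
Variables (G K : sigmaGroupType) (i j : nat) (ij : (i <= j)%N).
Variables (f : zquot G j -> zquot K j) (fh : sigma_hom f).

Let quot_pi1 (H : sigmaGroupType) k (x : H) :
  zassenhaus p H k x -> @pi H k x = 1.
Proof.
move=> Dx; apply/quot_piP; rewrite mulg1.
by have [_ _] := zassenhaus_subgroup p H k; apply.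
Qed.

Let theta : zquot K j -> zquot K i := quot_lift (@pi K i).

Let theta_hom : sigma_hom theta.
Proof.
apply: quot_lift_hom; first exact: quot_pi_hom.
by move=> x Dx; apply: quot_pi1; exact: zassenhaus_le Dx.
Qed.

Let thetaE x : theta (@pi K j x) = @pi K i x.
Proof.
apply: quot_liftE; first exact: quot_pi_hom.
by move=> y Dy; apply: quot_pi1; exact: zassenhaus_le Dy.
Qed.

Lemma zquot_descend : exists2 g : zquot G i -> zquot K i, sigma_hom g &
  forall x y, f (@pi G j x) = @pi K j y -> g (@pi G i x) = @pi K i y.
Proof.
have h : sigma_hom (theta \o f \o @pi G j).
  apply: sigma_hom_comp; first exact: quot_pi_hom.
  by apply: sigma_hom_comp.
have h1 x : zassenhaus p G i x -> (theta \o f \o @pi G j) x = 1.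
  move=> Dx /=.
  have : zassenhaus p (zquot K j) i (f (@pi G j x)).
    case: (fh) => fc fM _; apply: (zassenhaus_morph fc fM).
    by case: (quot_pi_hom (zassenhausN G j)) => pc pM _;
       exact: (zassenhaus_morph pc pM).
  move=> /(zquot_zassenhaus ij)[y Dy <-]; rewrite thetaE; exact: quot_pi1.
exists (quot_lift (theta \o f \o @pi G j)); first exact: quot_lift_hom.
by move=> x y fxy; rewrite [LHS]quot_liftE//= fxy thetaE.
Qed.

End Descend.

Lemma zquot_iso_le (G K : sigmaGroupType) i j : (i <= j)%N ->
  sigma_iso (zquot G j) (zquot K j) -> sigma_iso (zquot G i) (zquot K i).
Proof.
move=> ij [f [g [fh gh fg gf]]].
have [f' f'h f'E] := zquot_descend ij fh.
have [g' g'h g'E] := zquot_descend ij gh.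
exists f', g'; split=> //; elim/quot_ind => x.
- have := f'E x _ (esym (quot_reprK (f (@pi G j x)))) => ->.
  by apply: g'E; rewrite [X in g X]quot_reprK fg.
- have := g'E x _ (esym (quot_reprK (g (@pi K j x)))) => ->.
  by apply: f'E; rewrite [X in f X]quot_reprK gf.
Qed.

End ZassenhausQuotient.

Definition minus_part (G : sigmaGroupType) : set G := [set a | sigma a = a^-1].
Arguments minus_part G : clear implicits.

Definition minusT (G : sigmaGroupType) : Type := set_type (minus_part G).

Section MinusType.
Variable G : sigmaGroupType.

HB.instance Definition _ := Topological.on (minusT G).

Fact minus1 : (1 : G) \in minus_part G.
Proof.
rewrite inE /minus_part /= invg1.
by apply: (@mulIg _ (sigma 1)); rewrite -sigmaM !mul1g.
Qed.

HB.instance Definition _ := isPointed.Build (minusT G) (exist _ 1 minus1).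

End MinusType.

Notation borel T := (g_sigma_algebraType (@open T)).

(* free pro-p group on n generators, by its universal property, with the
   sigma-action inverting the generators *)
Record freeSigmaPro (p n : nat) := FreeSigmaPro {
  free_group :> sigmaGroupType;
  free_gen : 'I_n -> free_group;
  free_pro : pro_group p free_group;
  free_univ : forall (H : topGroupType) (y : 'I_n -> H), pro_group p H ->
    exists! f : free_group -> H,
      [/\ continuous f, {morph f : a b / a * b} &
          forall i, f (free_gen i) = y i];
  free_sigma : forall i, sigma (free_gen i) = (free_gen i)^-1
}.

Section Presented.
Variables (F : sigmaGroupType) (n : nat) (r : n.-tuple (minusT F)).

Definition relators : set F :=
  cgen [set x | exists i g, x = set_val (tnth r i) ^ g].

Fact relators_normal : is_normal relators.
Proof.
split=> [|x g]; first exact: cgen_subgroup.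
apply: (cgen_morph (f := fun x => x ^ g)); first exact: conjg_continuous.
  by move=> ? ?; rewrite conjMg.
by move=> y [i [h ->]]; apply: cgen_sub; exists i, (h * g); rewrite conjgM.
Qed.

Fact relators_sigma x : relators x -> relators (sigma x).
Proof.
apply: cgen_morph; [exact: sigma_continuous|exact: sigmaM|].
move=> y [i [g ->]]; have [_ _ RV] := cgen_subgroup
  [set x : F | exists i g, x = set_val (tnth r i) ^ g].
rewrite -[sigma _]invgK; apply: RV; apply: cgen_sub.
exists i, (sigma g); rewrite /conjg !sigmaM sigmaV.
have -> : sigma (set_val (tnth r i)) = (set_val (tnth r i))^-1.
  by have := set_valP (tnth r i).
by rewrite !invgM !invgK mulgA.
Qed.

Definition relatorsN := SigmaNormal relators_normal relators_sigma.

Definition presented : sigmaGroupType := quot relatorsN.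

End Presented.

Section Schur.
Variables (p : nat) (F : forall n, freeSigmaPro p n).

(* G_r is pro-p, being the quotient of a pro-p group by a closed normal
   subgroup, so that being pro-p is not repeated here *)
Definition weak_schur (G : sigmaGroupType) :=
  exists n (r : n.-tuple (minusT (F n))), sigma_iso G (presented r).

Definition strong_schur (G : sigmaGroupType) :=
  weak_schur G /\
  forall H : set G, open H -> is_subgroup H -> finite_abelianization H.

Definition presentation := {n & n.-tuple (minusT (F n))}.

Definition pres_group (c : presentation) : sigmaGroupType :=
  presented (tagged c).

Definition pres_iso (c d : presentation) : bool :=
  `[< sigma_iso (pres_group c) (pres_group d) >].

Fact pres_iso_equiv : equiv_class_of pres_iso.
Proof.
split=> [c|c d|d c e].
- by apply/asboolP; exact: sigma_iso_refl.
- by apply/asboolP/asboolP => /sigma_iso_sym.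
- by move=> /asboolP cd /asboolP de; apply/asboolP; exact: sigma_iso_trans de.
Qed.

Canonical pres_equiv := EquivRelPack pres_iso_equiv.

(* Every weak Schur group is isomorphic to some G_r, so the class of
   isomorphism classes is the set of presentations modulo isomorphism. *)
Definition Sch : Type := {eq_quot pres_equiv}.

HB.instance Definition _ := Choice.on Sch.
HB.instance Definition _ := Quotient.on Sch.

Definition schur_class n (r : n.-tuple (minusT (F n))) : Sch :=
  \pi_Sch (Tagged (fun n => n.-tuple (minusT (F n))) r).

Definition schur_group (c : Sch) : sigmaGroupType := pres_group (repr c).

Definition schur_basic (i : nat) (G : sigmaGroupType) : set Sch :=
  [set c | sigma_iso (zquot p (schur_group c) i) (zquot p G i)].

Definition schur_basis : set (set Sch) :=
  [set U | exists i G, [/\ (2 <= i)%N, weak_schur G & U = schur_basic i G]].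

Lemma schur_group_weak c : weak_schur (schur_group c).
Proof. by exists (tag (repr c)), (tagged (repr c)); exact: sigma_iso_refl. Qed.

Fact schur_basis_cover : \bigcup_(U in schur_basis) id U = setT.
Proof.
rewrite eqEsubset; split=> // c _; exists (schur_basic 2 (schur_group c)).
  by exists 2%N, (schur_group c); split=> //; exact: schur_group_weak.
exact: sigma_iso_refl.
Qed.

Fact schur_basis_join (U V : set Sch) c : schur_basis U -> schur_basis V ->
  id U c -> id V c ->
  exists W, [/\ schur_basis W, id W c & id W `<=` id U `&` id V].
Proof.
move=> [i [G [i2 _ ->]]] [j [K [j2 _ ->]]] cG cK.
exists (schur_basic (maxn i j) (schur_group c)); split.
- exists (maxn i j), (schur_group c); split=> //; last exact: schur_group_weak.
  by rewrite leq_max i2.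
- exact: sigma_iso_refl.
move=> d dc; split; (apply: sigma_iso_trans; last by [exact: cG|exact: cK]);
  apply: zquot_iso_le dc; [exact: leq_maxl|exact: leq_maxr].
Qed.

HB.instance Definition _ :=
  isBaseTopological.Build Sch schur_basis_cover schur_basis_join.

HB.instance Definition _ :=
  isPointed.Build Sch (schur_class [tuple of nseq 0 point]).

Definition Sch_strong : set Sch := [set c | strong_schur (schur_group c)].

End Schur.
Arguments schur_basis {p} F.
Arguments Sch_strong {p} F.

Section ProductProbability.
Local Open Scope ereal_scope.
Context (R : realType) (d : measure_display) (T : measurableType d).
Variable P : probability T R.

Let cons_tup n (z : T * n.-tuple T) : n.+1.-tuple T := [tuple of z.1 :: z.2].

Let cons_tup_measurable n : measurable_fun [set: T * n.-tuple T] (@cons_tup n).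
Proof. by apply: measurable_cons; [exact: measurable_fst|exact: measurable_snd]. Qed.

HB.instance Definition _ n := isMeasurableFun.Build _ _ _ _ (@cons_tup n)
  (@cons_tup_measurable n).

Fixpoint power_probability n : probability (n.-tuple T) R :=
  if n is n'.+1 then
    distribution (P \x power_probability n') (@cons_tup n')
  else dirac [tuple].

End ProductProbability.

Section Measure.
Local Open Scope ereal_scope.
Context (R : realType).

(* [N] is a sigma-stable normal subgroup; when it is open in a profinite group
   the quotient is finite, so that [fset_set] gives its actual cardinality *)
Definition is_haar (G : sigmaGroupType)
    (m : probability (borel (minusT G)) R) :=
  forall N : sigmaNormal G, open (nset N) ->
  forall a, minus_part (quot N) a ->
    m [set x | quot_pi N (set_val x) = a] =
    ((#|` fset_set (minus_part (quot N))|%fset)%:R^-1)%R%:E.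

Variables (p : nat) (F : forall n, freeSigmaPro p n).
Variable haar : forall n, probability (borel (minusT (F n))) R.

Definition mu_fin n : set (Sch F) -> \bar R :=
  fun A => power_probability (haar n) n (@schur_class p F n @^-1` A).

(* If the limit did not exist, [lim] would be 0. *)
Definition mu_infty (A : set (Sch F)) : \bar R := lim (mu_fin n A @[n --> \oo]).

End Measure.

(* Main.v *)
From HB Require Import structures.
Require Import Defs.
From mathcomp Require Import all_boot all_order all_algebra all_fingroup all_solvable.
From mathcomp Require Import finmap zify ring.
From mathcomp Require Import all_classical all_reals all_analysis borel_hierarchy.
Local Open Scope classical_set_scope.

(* For a finitely generated pro-p group G, being strong means that every
   D_i(G) has finite abelianization.  This is an open condition on G: if
   D_i(G)^(p^k) lies in [D_i(G), D_i(G)], the same holds modulo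
   D_i^(p^(k+1)) [D_i, D_i] for all K with K / D_j(K) = G / D_j(G), j large,
   and a finitely generated abelian pro-p group A with
   p^k A contained in p^(k+1) A is finite.  Hence the strong classes form a
   countable intersection of open sets.

   In fact mu_n(strong) = 1 for every n.  Fix H open, normal and sigma-stable
   in F_n, let q = [F_n : H] and M = H_ab.  The transfer-like map
     tau(w) = sum over g in F_n / H of s(g w)^-1 s(g) w
   is a crossed homomorphism F_n -> M which is multiplication by q on H.
   Symmetrizing it under sigma and correcting tau(x_i) by a square root of x_i
   modulo H yields u_1, ..., u_n in M^- whose conjugates span a subgroup
   containing 2 q M.  If r_1, ..., r_n in M^- are arbitrary, then r + k u spans
   a subgroup of finite index for all but at most m = rank M integers k, since
   the bad k are roots of a monic characteristic polynomial of degree m.  Since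
   all translates by k u are equidistributed, bad tuples have measure at most
   m / K for every K.  To avoid Z_p-linear algebra, this is carried out with
   integer matrices in the finite quotients H / H^(p^s) [H, H]. *)

Set Implicit Arguments.
Unset Strict Implicit.
Unset Printing Implicit Defensive.

(** * Subgroups of finite index in topological groups *)

(** The relators are confined to $M^-$, and a priori their conjugates might always span a submodule
    of infinite index. A single tuple $u$ in $M^-$ with a span of finite index rules this out,
    because the translates $r + k u$ can then be compared with $k u$ through a determinant. Such a
    tuple comes from a crossed homomorphism: all its values lie in the span of the conjugates of its
    values at generators, and on $H$ it is a multiplication by a nonzero integer. So $n$ generators
    yield exactly $n$ vectors, as many as there are relators.

    A second obstacle is that the preimage of $D_i(G_r)$ in $F_n$ varies with $r$. It contains the
    open subgroup $D_i(F_n)$, so only finitely many $H$ occur, and one null set is discarded for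
    each.

    The criterion that compares exponents $p^k$ and $p^{k+1}$ serves twice: it makes finiteness
    stable under small changes of the group, and it reduces the bad tuples to a count in a finite
    quotient. *)

Section TopologicalGroups.
Local Open Scope group_scope.
Variable G : topGroupType.
Implicit Types (A B H K N : set G) (s : seq G).

(** Representatives of left cosets are listed without asking that [N] lie in [H]; this form is
    monotone in [N] and restricts to smaller [H]. *)
Definition fin_idx H N := exists2 s : seq G,
  (forall x, x \in s -> H x) &
  forall x, H x -> exists2 t, t \in s & N (t^-1 * x).

Definition fgen H := exists s : seq G, H = cgen [set x | x \in s].

Lemma mulgl_continuous (a : G) : continuous (fun x => a * x).
Proof. by move=> x; apply: mulg_cvg; [exact: cvg_cst|exact: cvg_id]. Qed.

Lemma mulgr_continuous (a : G) : continuous (fun x => x * a).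
Proof. by move=> x; apply: mulg_cvg; [exact: cvg_id|exact: cvg_cst]. Qed.

Lemma expg_continuous n : continuous (fun x : G => x ^+ n).
Proof.
elim: n => [|n IH] x.
  by rewrite (_ : (fun _ => _) = cst 1)//; exact: cvg_cst.
rewrite (_ : (fun _ => _) = (fun y => y * y ^+ n)).
  by apply: mulg_cvg; [exact: cvg_id|exact: IH].
by apply/funext => y; rewrite expgS.
Qed.

Lemma subgroupX H n x : is_subgroup H -> H x -> H (x ^+ n).
Proof.
by move=> [H1 HM HV] Hx; elim: n => [|n IH]; rewrite ?expg0// expgS; exact: HM.
Qed.

Lemma subgroupR H x y : is_subgroup H -> H x -> H y -> H [~ x, y].
Proof.
by move=> [H1 HM HV] Hx Hy; rewrite /commg /conjg; apply: (HM);
  [exact: HV|apply: (HM); [exact: HV|exact: HM]].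
Qed.

Lemma subgroup_mulVr H x y : is_subgroup H -> H (x^-1 * y) -> H (y^-1 * x).
Proof. by move=> [_ _ HV] /HV; rewrite invgM invgK. Qed.

Lemma subgroup_mulVtrans H x y z : is_subgroup H ->
  H (x^-1 * y) -> H (y^-1 * z) -> H (x^-1 * z).
Proof. by move=> [_ HM _] xy yz; have := HM _ _ xy yz; rewrite mulgA mulgK. Qed.

Lemma closed_seqU (T : eqType) (s : seq T) (P : T -> set G) :
  (forall t, closed (P t)) -> closed [set x | exists2 t, t \in s & P t x].
Proof.
move=> cP; elim: s => [|t s IH].
  rewrite (_ : [set _ | _] = set0); first exact: closed0.
  by apply/seteqP; split=> // x [].
rewrite (_ : [set _ | _] = P t `|` [set x | exists2 t, t \in s & P t x]).
  by apply: closedU.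
apply/seteqP; split=> x /=.
  move=> [u]; rewrite inE => /predU1P[->|us] Px; first by left.
  by right; exists u.
move=> [Px|[u us Px]]; first by exists t; rewrite // mem_head.
by exists u; rewrite // inE us orbT.
Qed.

Lemma closed_lcoset N (t : G) : closed N -> closed [set x | N (t^-1 * x)].
Proof.
by move=> cN; apply: (preimage_closed (f := fun x => t^-1 * x)) => // x _;
  exact: mulgl_continuous.
Qed.

Lemma open_lcoset N (t : G) : open N -> open [set x | N (t^-1 * x)].
Proof.
by move=> oN; apply: (open_comp (f := fun x => t^-1 * x)) => // x _;
  exact: mulgl_continuous.
Qed.

Lemma open_subgroup_nbhs H : is_subgroup H -> nbhs 1 H -> open H.
Proof.
move=> [H1 HM HV] nH; rewrite openE => x Hx.
have : nbhs x [set y | H (x^-1 * y)].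
  by apply: (@mulgl_continuous x^-1 x); rewrite /= mulVg.
by apply: filterS => y /= /(HM _ _ Hx); rewrite mulVKg.
Qed.

Lemma open_subgroup_closed H : is_subgroup H -> open H -> closed H.
Proof.
move=> [H1 HM HV] oH; rewrite -[H]setCK; apply: open_closedC.
rewrite openE => x nHx.
have : nbhs x [set y | H (x^-1 * y)].
  by apply: open_nbhs_nbhs; split; [exact: open_lcoset|rewrite /= mulVg].
apply: filterS => y /= Hxy Hy; apply: nHx.
by have := HM _ _ Hy (HV _ Hxy); rewrite invgM invgK mulVKg.
Qed.

Lemma fin_idxP H N : is_subgroup H -> is_subgroup N ->
  finite_set (cosets H N) <-> fin_idx H N.
Proof.
move=> [H1 HM HV] sN; have [N1 NM NV] := sN; split.
  move=> /finite_fsetP[D DE].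
  have h (C : set G) : exists t : G,
      cosets H N C -> H t /\ C = [set t * y | y in N].
    have [[t Ht ->]|nC] := pselect (cosets H N C); first by exists t.
    by exists 1.
  have [r rP] := choice h.
  exists [seq r C | C <- D & `[< cosets H N C >]].
    move=> x /mapP[C]; rewrite mem_filter => /andP[/asboolP/rP[Hr _] _ ->] //.
  move=> x Hx; pose C := [set x * y | y in N].
  have CC : cosets H N C by exists x.
  exists (r C).
    apply/mapP; exists C => //; rewrite mem_filter; apply/andP; split.
      exact/asboolP.
    by have : [set` D] C by rewrite -DE.
  have [_ CE] := rP _ CC.
  have Cx : C x by exists 1; rewrite ?mulg1.
  have : [set r C * y | y in N] x by rewrite -CE.
  by move=> [y Ny <-]; rewrite mulKg.
move=> [s sH sP].
apply: (@sub_finite_set _ _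
    [set C | exists2 t, t \in s & C = [set t * y | y in N]]).
  move=> C [x /sP[t ts Ntx] ->]; exists t => //.
  apply/seteqP; split=> z [y Ny <-].
    exists (t^-1 * x * y); first exact: NM.
    by rewrite -!mulgA mulVKg.
  exists ((t^-1 * x)^-1 * y); first by apply: NM => //; exact: NV.
  by rewrite invgM invgK mulgA mulgA mulgV mul1g.
rewrite (_ : [set _ | _] = (fun t => [set t * y | y in N]) @` [set` s]).
  exact: finite_image.
by apply/seteqP; split=> C /= [t ts Ct]; exists t.
Qed.

Lemma fin_idxS H N N' : N `<=` N' -> fin_idx H N -> fin_idx H N'.
Proof.
move=> NN' [s sH sP]; exists s => // x /sP[t ts Nt].
by exists t => //; exact: NN'.
Qed.

Lemma fin_idx_trans H K N : K `<=` H -> is_subgroup H ->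
  fin_idx H K -> fin_idx K N -> fin_idx H N.
Proof.
move=> KH [_ HM _] [s sH sP] [s' s'K s'P].
exists [seq t * t' | t <- s, t' <- s'].
  by move=> x /allpairsP[[t t'] /= [/sH Ht /s'K/KH Ht' ->]]; exact: HM.
move=> x /sP[t ts /s'P[t' t's Nx]]; exists (t * t').
  by apply/allpairsP; exists (t, t').
by rewrite invgM -mulgA.
Qed.

Lemma fin_idx_sub H K N : K `<=` H -> is_subgroup N -> fin_idx H N ->
  fin_idx K N.
Proof.
move=> KH sN [s sH sP].
have h (t : G) : exists t', (exists2 x, K x & N (t^-1 * x)) ->
    K t' /\ N (t^-1 * t').
  have [[x Kx Nx]|n] := pselect (exists2 x, K x & N (t^-1 * x)).
    by exists x.
  by exists 1.
have [r rP] := choice h.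
exists [seq r t | t <- s & `[< exists2 x, K x & N (t^-1 * x) >]].
  by move=> x /mapP[t]; rewrite mem_filter => /andP[/asboolP/rP[]] ? ? ? ->.
move=> x Kx; have [t ts Nx] := sP _ (KH _ Kx).
have tx : exists2 x, K x & N (t^-1 * x) by exists x.
exists (r t).
  by apply: map_f; rewrite mem_filter ts andbT; exact/asboolP.
have [_ Nr] := rP _ tx.
exact: subgroup_mulVtrans (subgroup_mulVr sN Nr) Nx.
Qed.

(** [N] is what remains of the open set [H] once the finitely many closed cosets [t N] with [t]
    outside [N] are removed. *)
Lemma closed_fin_idx_open H N : open H -> is_subgroup N -> closed N ->
  N `<=` H -> fin_idx H N -> open N.
Proof.
move=> oH sN cN NH [s sH sP].
have -> : N = H `&` ~` [set x | exists2 t, t \in [seq t <- s | ~~ `[< N t >]]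
    & N (t^-1 * x)].
  apply/seteqP; split=> x /=.
    move=> Nx; split; first exact: NH.
    move=> [t]; rewrite mem_filter => /andP[/asboolPn nt _] Ntx; apply: nt.
    case: sN => _ NM NV.
    by have := NM _ _ Nx (NV _ Ntx); rewrite invgM invgK mulVKg.
  move=> [/sP[t ts Ntx] n]; case: (sN) => _ NM _.
  rewrite -(mulVKg t x); apply: NM => //.
  apply: contrapT => nt; apply: n; exists t => //.
  by rewrite mem_filter ts andbT; exact/asboolPn.
apply: openI => //; apply: closed_openC; apply: closed_seqU => t.
exact: closed_lcoset.
Qed.

Lemma open_fin_idx U : compact [set: G] -> is_subgroup U -> open U ->
  fin_idx [set: G] U.
Proof.
move=> cG [U1 UM UV] oU.
(* Compactness by covers is applied to the same space with 1 as base point. *)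
pose T : ptopologicalType :=
  HB.pack (G : Type) (TopGroup.class G) (isPointed.Build G 1).
have : @compact T setT := cG.
rewrite compact_cover => /(_ G setT (fun t => [set x | U (t^-1 * x)])).
case=> [t _|x _|D _ DP]; first exact: open_lcoset.
  by exists x => //=; rewrite mulVg.
exists (enum_fset D) => // x _; have [t /= tD Ux] := DP x I.
Qed.

(** Schreier's argument for closed subgroups: with [T] a finite list of representatives of the
    cosets [H t] and [K] generated by the Schreier elements, the union [S] of the cosets [K t] is
    closed and stable under right multiplication by the generators and their inverses, hence by all
    of [G]. *)
Lemma schreier H : fgen [set: G] -> is_subgroup H -> open H ->
  fin_idx [set: G] H -> fgen H.
Proof.
move=> [gs gE] sH oH [s _ sP].
have cH := open_subgroup_closed sH oH; have [H1 HM HV] := sH.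
pose T := [seq t^-1 | t <- s].
have TP x : exists2 t, t \in T & H (x * t^-1).
  have [t ts Ht] := sP x^-1 I; exists t^-1; first exact: map_f.
  by rewrite invgK; have := HV _ Ht; rewrite invgM !invgK.
(* [T] need not contain 1, so its members in [H] are added to the Schreier elements. They put 1 into
   [S] and finally bring an element of [H] from [K t] back into [K]. *)
pose A := [seq x <- [seq y * z^-1 | y <- [seq t * g | t <- T, g <- gs],
  z <- T] ++ T | `[< H x >]].
exists A; pose K := cgen [set x | x \in A]; rewrite -/K.
have [K1 KM KV] : is_subgroup K by exact: cgen_subgroup.
have KA x : x \in A -> K x by move=> xA; exact: cgen_sub.
pose S := [set x | exists2 t, t \in T & K (x * t^-1)].
have cS : closed S.
  apply: (closed_seqU (P := fun t => [set x | K (x * t^-1)])) => t.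
  apply: (preimage_closed (f := fun x => x * t^-1)); last exact: cgen_closed.
  by move=> x _; exact: mulgr_continuous.
have SA : [set x | x \in gs] `<=`
    [set g | forall x, S x -> S (x * g) /\ S (x * g^-1)].
  move=> g /= ggs x [t tT Kt]; split.
    have [t' t'T Ht'] := TP (t * g).
    exists t' => //; rewrite -(mulgVK t x) -!mulgA; rewrite [x * _]mulgA.
    apply: KM => //; apply: KA; rewrite mem_filter asboolT/= ?mem_cat.
      apply/orP; left; apply/allpairsP; exists (t * g, t'); split => //=.
        by apply/allpairsP; exists (t, g).
      by rewrite mulgA.
    by rewrite mulgA.
  have [t' t'T Ht'] := TP (t * g^-1).
  exists t' => //; rewrite -(mulgVK t x) -!mulgA; rewrite [x * _]mulgA.
  apply: KM => //.
  (* The step by [g^-1] from [t] to [t'] is the inverse of the Schreier element for the step by [g]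
     from [t'] to [t]. *)
  have -> : t * (g^-1 * t'^-1) = (t' * g * t^-1)^-1.
    by rewrite !invgM invgK mulgA.
  apply: KV; apply: KA; rewrite mem_filter asboolT/= ?mem_cat.
    apply/orP; left; apply/allpairsP; exists (t' * g, t); split => //=.
    by apply/allpairsP; exists (t', g).
  by have := HV _ Ht'; rewrite !invgM !invgK mulgA.
have SG : [set: G] `<=` [set g | forall x, S x -> S (x * g) /\ S (x * g^-1)].
  rewrite gE; apply: cgen_min => //.
  - rewrite (_ : [set g | _] = \bigcap_(x in S)
        ([set g | S (x * g)] `&` [set g | S (x * g^-1)])); last first.
      by apply/seteqP; split=> y h x; apply: h.
    apply: closed_bigI => x _; apply: closedI.
      apply: (preimage_closed (f := fun g => x * g)) => // y _.
      exact: mulgl_continuous.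
    apply: (preimage_closed (f := fun g => x * g^-1)) => // y _.
    apply: mulg_cvg; first exact: cvg_cst.
    exact: invg_continuous.
  - split=> [x Sx|a b aP bP x Sx|a aP x Sx].
    + by rewrite invg1 !mulg1.
    + rewrite invgM !mulgA; split.
        by have [/bP[] ] := aP _ Sx.
      by have [_ /aP[] ] := bP _ Sx.
    + by rewrite invgK; have [] := aP _ Sx.
have S1 : S 1.
  have [t tT Ht] := TP 1; exists t => //; rewrite mul1g; apply: KV; apply: KA.
  rewrite mem_filter mem_cat tT orbT andbT; apply/asboolP.
  by move: Ht; rewrite mul1g => /HV; rewrite invgK.
apply/seteqP; split.
  move=> h Hh; have [] := SG h I 1 S1; rewrite mul1g => -[t tT Kt] _.
  rewrite -(mulgVK t h); apply: KM => //; apply: KA.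
  rewrite mem_filter mem_cat tT orbT andbT; apply/asboolP.
  have : K `<=` H.
    apply: cgen_min => //.
      by move=> x /=; rewrite mem_filter => /andP[/asboolP].
  move=> /(_ _ Kt) Hht; have := HM _ _ (HV _ Hht) Hh.
  by rewrite invgM invgK mulgVK.
apply: cgen_min => //.
by move=> x /=; rewrite mem_filter => /andP[/asboolP].
Qed.

End TopologicalGroups.

(** * Abelian sections of topological groups *)

Section AbelianSections.
Local Open Scope group_scope.
Variable G : topGroupType.
Implicit Types (A B H K N : set G) (s : seq G).

Definition abelian_section H B :=
  [/\ is_subgroup H, is_subgroup B, B `<=` H &
      forall x y, H x -> H y -> B [~ x, y]].

Definition power_comm (H : set G) (e : nat) : set G :=
  cgen ([set x ^+ e | x in H] `|`
        [set z | exists x y, [/\ H x, H y & z = [~ x, y]]]).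

Section Section.
Variables (H B : set G) (HB : abelian_section H B).

Lemma section_conj b x : B b -> H x -> B (b ^ x).
Proof.
have [_ [_ BM _] BH BR] := HB.
move=> Bb Hx; rewrite -(mulVKg b (b ^ x)) -commgEl.
by apply: BM => //; apply: BR => //; exact: BH.
Qed.

Lemma section_mul x x' y y' : H y ->
  B (x^-1 * x') -> B (y^-1 * y') -> B ((x * y)^-1 * (x' * y')).
Proof.
have [_ [_ BM _] BH BR] := HB.
move=> Hy xx yy.
have -> : (x * y)^-1 * (x' * y') = (x^-1 * x') ^ y * (y^-1 * y').
  by rewrite /conjg invgM -!mulgA mulVKg.
by apply: BM => //; exact: section_conj.
Qed.

Lemma section_expM x y n : H x -> H y ->
  B ((x ^+ n * y ^+ n)^-1 * (x * y) ^+ n).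
Proof.
have [sH sB BH BR] := HB; have [H1 HM HV] := sH; have [B1 BM BV] := sB.
move=> Hx Hy; elim: n => [|n IH]; first by rewrite !expg0 !mulg1 invg1.
rewrite (expgSr (x * y)).
apply: (@subgroup_mulVtrans _ _ _ (x ^+ n * y ^+ n * (x * y))) => //; last first.
  by apply: section_mul; rewrite ?mulVg//; exact: HM.
have Hyn : H (y ^+ n) by exact: subgroupX.
have -> : x ^+ n.+1 * y ^+ n.+1 = (x ^+ n * (x * y ^+ n)) * y.
  by rewrite !expgSr !mulgA.
have -> : x ^+ n * y ^+ n * (x * y) = (x ^+ n * (y ^+ n * x)) * y.
  by rewrite !mulgA.
apply: section_mul; rewrite ?mulVg//.
apply: section_mul; rewrite ?mulVg//; first exact: HM.
have -> : (x * y ^+ n)^-1 * (y ^+ n * x) = [~ y ^+ n, x].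
  by rewrite /commg /conjg invgM -!mulgA.
exact: BR.
Qed.

Lemma section_root_subgroup n : is_subgroup [set x | H x /\ B (x ^+ n)].
Proof.
have [sH sB BH BR] := HB; have [H1 HM HV] := sH; have [B1 BM BV] := sB.
split=> /= [|x y [Hx Bx] [Hy By]|x [Hx Bx]].
- by rewrite expg1n.
- split; first exact: HM.
  rewrite -(mulVKg (x ^+ n * y ^+ n) ((x * y) ^+ n)); apply: (BM).
    exact: BM.
  exact: section_expM.
- by rewrite expVgn; split; [exact: HV|exact: BV].
Qed.

(** [C] is the union of the cosets [h^i B] for [i < e]; finiteness of the union makes it closed, and
    [h^((e-1) i)] is an inverse of [h^i] modulo [B]. *)
Lemma section_adjoin h e : closed B -> H h -> (0 < e)%N -> B (h ^+ e) ->
  exists C, [/\ closed C, is_subgroup C, B `<=` C, C `<=` H &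
    C h /\ fin_idx C B].
Proof.
have [sH sB BH BR] := HB; have [H1 HM HV] := sH; have [B1 BM BV] := sB.
move=> cB Hh e0 Bhe.
pose s := [seq h ^+ i | i <- iota 0 e].
pose C := [set x | exists2 t, t \in s & B (t^-1 * x)].
have hX i : B (h ^- (i %% e) * h ^+ i).
  rewrite {2}(divn_eq i e) addnC expgnDr mulKg mulnC expgnA.
  exact: subgroupX.
have Cs i x : B (h ^- i * x) -> C x.
  move=> Bx; exists (h ^+ (i %% e)).
    by apply: map_f; rewrite mem_iota /= add0n ltn_mod.
  exact: subgroup_mulVtrans (hX i) Bx.
have CP x : C x -> exists i, B (h ^- i * x).
  by move=> [_ /mapP[i _ ->] Bx]; exists i.
have Hi i : H (h ^+ i) by exact: subgroupX.
have BC : B `<=` C by move=> x Bx; apply: (Cs 0%N); rewrite expg0 invg1 mul1g.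
have CH : C `<=` H.
  by move=> x /CP[i /BH Bx]; rewrite -(mulVKg (h ^+ i) x); exact: HM.
exists C; split=> //.
- apply: (closed_seqU (P := fun t => [set x | B (t^-1 * x)])) => t.
  exact: closed_lcoset.
- split; first exact: BC.
  + move=> x y /CP[i Bx] /CP[j By]; apply: (Cs (i + j)%N).
    by rewrite expgnDr; exact: section_mul.
  + move=> x Cx; have /CP[i Bx] := Cx; apply: (Cs (e.-1 * i)%N).
    have Hx : H x by exact: CH.
    have Byx : B (h ^+ (e.-1 * i) * x).
      rewrite -(mulVKg (h ^+ i) x) mulgA; apply: (BM) => //.
      by rewrite -expgnDr -mulSnr prednK// expgnA; exact: subgroupX.
    have := BV _ (section_conj Byx (HV _ Hx)).
    by rewrite /conjg invgK !mulgA mulgK invgM.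
- split; first by apply: (Cs 1%N); rewrite expg1 mulVg.
  exists s => //; move=> _ /mapP[i _ ->]; apply: (Cs i); rewrite mulVg.
  exact: B1.
Qed.
End Section.

(** The generators of [H] are adjoined to [N] one at a time; each step keeps a closed subgroup in
    which [N] has finite index, and the last one is [H]. *)
Lemma fgen_torsion_fin_idx H N e : abelian_section H N -> closed N ->
  fgen H -> (0 < e)%N -> (forall x, H x -> N (x ^+ e)) -> fin_idx H N.
Proof.
move=> HN cN [s HE] e0 He.
have sH x : x \in s -> H x by move=> xs; rewrite HE; exact: cgen_sub.
suff [C [cC sC NC CH [Cs fC]]] : exists C, [/\ closed C, is_subgroup C,
    N `<=` C, C `<=` H & (forall x, x \in s -> C x) /\ fin_idx C N].
  rewrite [X in fin_idx X](_ : H = C)//; apply/seteqP; split=> // x.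
  by rewrite HE; apply: cgen_min.
elim: s sH {HE} => [|h s IH] sH.
  have [_ sN NH _] := HN; exists N; split=> //; split=> //.
  exists [:: 1]; first by move=> x; rewrite inE => /eqP ->; case: sN.
  by move=> x Nx; exists 1; rewrite ?inE// invg1 mul1g.
have [|C [cC sC NC CH [Cs fC]]] := IH.
  by move=> x xs; apply: sH; rewrite inE xs orbT.
have HC : abelian_section H C.
  by case: HN => ? _ _ HR; split=> // x y Hx Hy; apply: NC; exact: HR.
have Hh : H h by apply: sH; rewrite mem_head.
have [|C' [cC' sC' CC' C'H [C'h fC']]] := section_adjoin HC cC Hh e0.
  by apply: NC; exact: He.
exists C'; split=> //; first exact: subset_trans CC'.
split; last exact: fin_idx_trans fC.
by move=> x; rewrite inE => /predU1P[->//|/Cs/CC'].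
Qed.
End AbelianSections.

Lemma zassenhaus_antimono p (G : topGroupType) i j : (i <= j)%N ->
  zassenhaus p G j `<=` zassenhaus p G i.
Proof.
move=> /subnK <-; elim: (j - i)%N => // n IH.
exact: subset_trans (@zassenhausS _ _ _) IH.
Qed.

(** * Finite quotients of pro-p groups *)

Section FiniteQuotients.
Local Open Scope group_scope.
Variables (p : nat) (G : topGroupType).
Hypothesis p_prime : prime p.
Implicit Types (A B H K N : set G) (s : seq G).

(** A continuous surjection onto a finite p-group; openness of the kernel stands in for a discrete
    topology on [gT]. *)
Definition pquot (gT : finGroupType) (X : {group gT}) (f : G -> gT) :=
  [/\ {morph f : x y / x * y}, forall x, f x \in X,
      forall y, y \in X -> exists x, f x = y, p.-group X &
      open (f @^-1` [set 1])].

Section Theory.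
Variables (gT : finGroupType) (X : {group gT}) (f : G -> gT).
Hypothesis fX : pquot X f.

Let fM : {morph f : x y / x * y}. Proof. by case: fX. Qed.

Lemma pquot1 : f 1 = 1.
Proof. by apply: (@mulIg _ (f 1)); rewrite -fM !mul1g. Qed.

Lemma pquotV x : f x^-1 = (f x)^-1.
Proof. by apply: (@mulIg _ (f x)); rewrite -fM !mulVg pquot1. Qed.

Lemma pquotMV x y : f (x^-1 * y) = (f x)^-1 * f y.
Proof. by rewrite fM pquotV. Qed.

Lemma pquot_expg x n : f (x ^+ n) = f x ^+ n.
Proof.
by elim: n => [|n IH]; rewrite ?expg0 ?pquot1// !expgS fM IH.
Qed.

Lemma pquotR x y : f [~ x, y] = [~ f x, f y].
Proof. by rewrite /commg /conjg !fM !pquotV. Qed.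

Lemma pquot_preimage_open (A : set gT) : open (f @^-1` A).
Proof.
case: fX => _ _ _ _ of1; rewrite openE => x /= Ax.
have : nbhs x [set y | (f @^-1` [set 1]) (x^-1 * y)].
  apply: open_nbhs_nbhs; split; first exact: open_lcoset.
  by rewrite /= mulVg pquot1.
apply: filterS => y /=; rewrite pquotMV => /mulg1_eq; rewrite invgK.
by rewrite /interior => <-.
Qed.

Lemma pquot_preimage_closed (A : set gT) : closed (f @^-1` A).
Proof.
rewrite -[X in closed X]setCK; apply: open_closedC.
exact: (pquot_preimage_open (~` A)).
Qed.

Lemma pquot_kernel_normal : is_normal (f @^-1` [set 1]).
Proof.
split; first split=> /= [|x y fx fy|x fx].
- exact: pquot1.
- by rewrite fM fx fy mulg1.
- by rewrite pquotV fx invg1.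
by move=> x g /= fx; rewrite /conjg !fM pquotV fx mul1g mulVg.
Qed.

Lemma pquot_image H : is_subgroup H ->
  exists Y : {group gT}, Y \subset X /\
    (forall y, y \in Y <-> exists2 x, H x & f x = y).
Proof.
move=> [H1 HM HV].
pose Y := [set y | `[< exists2 x, H x & f x = y >]]%SET.
have gY : group_set Y.
  apply/group_setP; split.
    by rewrite !inE; exists 1; rewrite ?pquot1.
  move=> u v; rewrite !inE => -[x Hx <-] [y Hy <-].
  by exists (x * y); [exact: HM|exact: fM].
exists (Group gY); split.
  apply/fintype.subsetP => u; rewrite !inE => -[x Hx <-].
  by case: fX.
by move=> y; rewrite !inE.
Qed.

Lemma pquot_preimage_subgroup (Y : {group gT}) :
  is_subgroup [set x | f x \in Y].
Proof.
split=> /= [|x y xY yY|x xY]; rewrite ?pquot1 ?pquotV ?fM ?groupV//.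
exact: groupM.
Qed.

Lemma pquot_index :
  exists k, (cosets [set: G] (f @^-1` [set 1]) #= `I_(p ^ k))%card.
Proof.
case: (fX) => _ fin fsurj pX _.
have [k kE] := p_natP pX.
exists k; rewrite card_eq_sym; apply/card_set_bijP.
exists (fun i => [set x | f x = nth 1 (enum X) i]).
have sX : size (enum X) = (p ^ k)%N by rewrite -cardE.
split.
- move=> i /= ik; have /fsurj[x xE] : nth 1 (enum X) i \in X.
    by rewrite -mem_enum mem_nth// sX.
  exists x => //; apply/seteqP; split=> y /=.
    move=> yE; exists (x^-1 * y); last by rewrite mulVKg.
    by rewrite /= pquotMV yE xE mulVg.
  by move=> [z /= fz <-]; rewrite fM fz mulg1.
- move=> i j /[!inE] /= ik jk ijE.
  have /fsurj[x xE] : nth 1 (enum X) i \in X.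
    by rewrite -mem_enum mem_nth// sX.
  have : [set x | f x = nth 1 (enum X) i] x by [].
  rewrite ijE /= xE => /eqP; rewrite nth_uniq ?sX// ?enum_uniq//.
  by move/eqP.
- move=> _ [x _ ->].
  have xX : f x \in enum X by rewrite mem_enum; exact: fin.
  exists (index (f x) (enum X)); first by rewrite /= -sX index_mem.
  apply/seteqP; split=> y /=.
    rewrite nth_index// => yE; exists (x^-1 * y); last by rewrite mulVKg.
    by rewrite /= pquotMV yE mulVg.
  by move=> [z /= fz <-]; rewrite nth_index// fM fz mulg1.
Qed.

(** The first bound on [i] sends the p-th powers into ['Phi(Z)]. The second forces [j] or [i' - j]
    to be at least [i], which sends the commutators into [[~: Z, X]]. *)
Lemma pquot_zassenhaus_Phi i i' (Z : {group gT}) :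
  (1 < i')%N -> (i <= (i' + p.-1) %/ p)%N -> (i.*2 <= i'.+1)%N -> normal Z X ->
  (forall x, zassenhaus p G i x -> f x \in Z) ->
  forall x, zassenhaus p G i' x -> f x \in 'Phi(Z) <*> [~: Z, X].
Proof.
move=> i1 ip i2 nZ iZ; case: fX => _ fin _ pX _.
rewrite zassenhausE//.
apply: cgen_min.
- exact: (@pquot_preimage_closed (fun y => y \in 'Phi(Z) <*> [~: Z, X])).
- exact: pquot_preimage_subgroup.
have sPhi : 'Phi(Z) \subset 'Phi(Z) <*> [~: Z, X] by exact: joing_subl.
have sR : [~: Z, X] \subset 'Phi(Z) <*> [~: Z, X] by exact: joing_subr.
move=> z [[x xD <-]|[j /= /andP[j0 ji] zR]] /=.
  rewrite pquot_expg; apply: (fintype.subsetP sPhi).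
  have xZ : f x \in Z.
    by apply: iZ; exact: zassenhaus_antimono xD.
  have pZ : p.-group Z by apply: pgroupS pX; exact: normal_sub.
  rewrite (Phi_joing pZ); apply: mem_gen; rewrite inE; apply/orP; right.
  rewrite -[X in _ ^+ X]expn1; apply: Mho_p_elt => //.
  exact: mem_p_elt pZ xZ.
have : comm_subgroup (zassenhaus p G j) (zassenhaus p G (i' - j)) `<=`
    [set x | f x \in ('Phi(Z) <*> [~: Z, X])%G].
  apply: cgen_min.
  - exact: (@pquot_preimage_closed (fun y => y \in 'Phi(Z) <*> [~: Z, X])).
  - exact: pquot_preimage_subgroup.
  move=> _ [x [y [xj yj ->]]] /=; rewrite pquotR.
  apply: (fintype.subsetP sR).
  have [ij|ij] := leqP i j.
    by apply: mem_commg => //; apply: iZ; exact: zassenhaus_antimono xj.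
  rewrite commGC; apply: mem_commg => //; apply: iZ.
  by apply: zassenhaus_antimono yj; lia.
by apply.
Qed.

End Theory.

(** [G] permutes the cosets of [N], numbered by ['I_(p ^ k)]. As [N] is normal, it is exactly the
    kernel, and the image has order [p ^ k]. *)
Lemma pquot_of_index N k : open N -> is_normal N ->
  (cosets [set: G] N #= `I_(p ^ k))%card ->
  exists (gT : finGroupType) (X : {group gT}) (f : G -> gT),
    pquot X f /\ f @^-1` [set 1] = N.
Proof.
move=> oN [sN NJ]; have [N1 NM NV] := sN.
rewrite card_eq_sym => /card_set_bijP[c [cfun cinj csurj]].
have /choice[t tP] (i : 'I_(p ^ k)) : exists x : G, c i = [set x * y | y in N].
  by have [x _ ->] := cfun i (ltn_ord i); exists x.
have /choice[r rP] (x : G) : exists i : 'I_(p ^ k), N ((t i)^-1 * x).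
  have [|i /= ik ix] := csurj [set x * y | y in N]; first by exists x.
  have : [set x * y | y in N] x by exists 1; rewrite ?mulg1.
  rewrite -ix -[i]/(val (Ordinal ik)) tP => -[y Ny <-].
  by exists (Ordinal ik); rewrite mulKg.
have tinj i j : N ((t i)^-1 * t j) -> i = j.
  move=> Nij; apply/val_inj/cinj; rewrite ?inE ?ltn_ord//= !tP.
  apply/seteqP; split=> _ [y Ny <-].
    exists ((t j)^-1 * t i * y); last by rewrite -!mulgA mulVKg.
    by apply: (NM) => //; have := NV _ Nij; rewrite invgM invgK.
  by exists ((t i)^-1 * t j * y); [exact: NM|rewrite -!mulgA mulVKg].
have rinj x y : r x = r y -> N (x^-1 * y).
  move=> rxy; apply: (subgroup_mulVtrans sN (subgroup_mulVr sN (rP x))).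
  by rewrite rxy.
have req x y : N (x^-1 * y) -> r x = r y.
  move=> Nxy; apply: tinj.
  apply: (subgroup_mulVtrans sN (rP x)).
  exact: (subgroup_mulVtrans sN Nxy (subgroup_mulVr sN (rP y))).
have sinj x : injective (fun i => r (t i * x)).
  move=> i j /rinj; rewrite invgM -!mulgA [_^-1 * (t j * x)]mulgA => h.
  apply: tinj; have := NJ _ x^-1 h; rewrite /conjg invgK.
  by rewrite !mulgA mulgV mul1g mulgK.
pose f x : {perm 'I_(p ^ k)} := perm (@sinj x).
have fM : {morph f : x y / x * y}.
  move=> x y; apply/permP => i; rewrite permM !permE /=; apply: req.
  rewrite invgM -mulgA; have := NJ _ y (NV _ (rP (t i * x))).
  by rewrite /conjg !invgM !invgK !mulgA.
have f1 : f 1 = 1 by apply: (@mulIg _ (f 1)); rewrite -fM !mul1g.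
have fV x : f x^-1 = (f x)^-1.
  by apply: (@mulIg _ (f x)); rewrite -fM !mulVg f1.
have kf x : f x = 1 <-> N x.
  split=> [fx|Nx].
    have [i _] : exists i : 'I_(p ^ k), true by exists (r 1).
    have := permE (@sinj x) i; rewrite -/(f x) fx perm1 => ri.
    have := rP (t i * x); rewrite -ri; by rewrite mulKg.
  apply/permP => i; rewrite perm1 permE; apply: tinj.
  apply: (subgroup_mulVtrans sN (rP (t i * x))).
  by rewrite invgM mulgVK; exact: NV.
pose X := imset (fun i => f (t i)) (mem 'I_(p ^ k)).
have XE y : y \in X <-> exists x, f x = y.
  split=> [/imsetP[i _ ->]|[x <-]]; first by exists (t i).
  apply/imsetP; exists (r x) => //; apply: (@mulgI _ (f (t (r x)))^-1).
  by rewrite mulVg -fV -fM; apply/kf; exact: rP.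
have gX : group_set X.
  apply/group_setP; split; first by apply/XE; exists 1.
  by move=> u v /XE[x <-] /XE[y <-]; apply/XE; exists (x * y); rewrite fM.
have kfN : f @^-1` [set 1] = N by apply/seteqP; split=> x /kf.
exists {perm 'I_(p ^ k)}, (Group gX), f; split=> //; split=> //.
- by move=> x; apply/XE; exists x.
- by move=> y /XE.
- rewrite /pgroup card_imset /= ?card_ord ?pnatX ?pnat_id//.
  move=> i j fij; apply: tinj; apply/kf.
  by rewrite fM fV fij mulVg.
- by rewrite kfN.
Qed.

Hypothesis proG : pro_group p G.

Lemma pquot_nbhs U : nbhs 1 U ->
  exists (gT : finGroupType) (X : {group gT}) (f : G -> gT),
    pquot X f /\ f @^-1` [set 1] `<=` U.
Proof.
case: proG => _ _ /[apply] -[N [oN nN NU [k Nk]]].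
have [gT [X [f [fX fN]]]] := pquot_of_index oN nN Nk.
by exists gT, X, f; rewrite fN.
Qed.

(** Every neighbourhood of [x] contains a coset of the kernel of some [f], so [x] lies in the
    closure of [K]. *)
Lemma closed_pquotP K x : closed K ->
  (forall (gT : finGroupType) (X : {group gT}) (f : G -> gT), pquot X f ->
    exists2 y, K y & f y = f x) -> K x.
Proof.
move=> cK h; apply: cK => B nB.
have : nbhs 1 [set y | B (x * y)].
  by apply: (@mulgl_continuous _ x 1); rewrite /= mulg1.
move=> /pquot_nbhs[gT [X [f [fX fB]]]].
have [y Ky fy] := h _ _ _ fX; exists y; split=> //.
by rewrite -(mulVKg x y); apply: fB; rewrite /= (pquotMV fX) fy mulVg.
Qed.

(** The definition of a pro-p group controls only a basis of open normal subgroups. For an arbitrary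
    [N], a quotient with kernel inside [N] is divided by the image [Y] of [N]. *)
Lemma pquot_open_normal N : open N -> is_normal N ->
  exists (gT : finGroupType) (X : {group gT}) (f : G -> gT),
    pquot X f /\ f @^-1` [set 1] = N.
Proof.
move=> oN [sN NJ]; have [N1 NM NV] := sN.
have [gT [X [f [fX fN]]]] := pquot_nbhs (open_nbhs_nbhs (conj oN N1)).
have [Y [YX YP]] := pquot_image fX sN.
have [fM fin fsurj pX of1] := fX.
have nXY : X \subset 'N(Y).
  apply/normsP => _ /fsurj[g <-]; apply/setP => z.
  rewrite mem_conjg; apply/idP/idP => /YP[x Nx].
    move=> /(congr1 (fun z => z ^ f g)); rewrite conjgKV => <-.
    apply/YP; exists (x ^ g); first exact: NJ.
    by rewrite /conjg !fM (pquotV fX).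
  move=> <-; apply/YP; exists (x ^ g^-1); first exact: NJ.
  by rewrite /conjg !fM !(pquotV fX).
have fNX x : f x \in 'N(Y) by apply: (fintype.subsetP nXY).
exists (coset_of Y), (X / Y)%G, (fun x => coset Y (f x)).
have kE : (fun x => coset Y (f x)) @^-1` [set 1] = N.
  apply/seteqP; split=> x /=; last first.
    by move=> Nx; apply: coset_id; apply/YP; exists x.
  move=> /coset_idr -/(_ (fNX x))/YP[y Ny fyx].
  rewrite -(mulVKg y x); apply: (NM) => //; apply: fN.
  by rewrite /= (pquotMV fX) fyx mulVg.
split=> //; split=> //.
- by move=> x y; rewrite fM morphM.
- by move=> x; apply: mem_quotient.
- move=> y /morphimP[_ _ /fsurj[x <-] ->]; by exists x.
- exact: quotient_pgroup.
- by rewrite kE.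
Qed.

(** In a finite p-group [X], the subgroup ['Phi(Z) <*> [~: Z, X]] is strictly smaller than a
    nontrivial normal [Z]. Passing from [D_i] to [D_(p i)] thus shrinks the bound on the image until
    it is trivial. *)
Lemma zassenhaus_nbhs U : nbhs 1 U ->
  exists2 i, (0 < i)%N & zassenhaus p G i `<=` U.
Proof.
move=> /pquot_nbhs[gT [X [f [fX fU]]]].
suff [i i0 iP] : exists2 i, (0 < i)%N & zassenhaus p G i `<=` f @^-1` [set 1].
  by exists i => //; exact: subset_trans iP fU.
have [fM fin fsurj pX of1] := fX.
suff h n : forall Z : {group gT}, (#|Z| < n)%N -> normal Z X ->
    (exists2 i, (0 < i)%N & forall x, zassenhaus p G i x -> f x \in Z) ->
    exists2 i, (0 < i)%N & zassenhaus p G i `<=` f @^-1` [set 1].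
  by apply: (h _ X (ltnSn _) (normal_refl X)); exists 1%N.
elim: n => // n IH Z Zn nZ [i i0 iZ].
have [Z1|Z1] := eqVneq (Z : {set gT}) 1.
  by exists i => // x /iZ; rewrite Z1 => /set1P.
have [sZX nXZ] := andP nZ.
have pZ : p.-group Z by exact: pgroupS pX.
apply: (IH ('Phi(Z) <*> [~: Z, X])%G); last first.
- exists (p * i)%N; first by rewrite muln_gt0 prime_gt0.
  have p1 := prime_gt1 p_prime.
  apply: (pquot_zassenhaus_Phi fX _ _ _ nZ iZ); [nia| |nia].
  by rewrite mulnC leq_divRL ?leq_addr// ltnW.
- apply: normalY; first exact: gFnormal_trans.
  apply/andP; split; last by rewrite normsRr.
  by apply: fintype.subset_trans sZX; rewrite commg_subl.
rewrite ltnS in Zn; apply: leq_trans Zn; apply: proper_card.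
rewrite finset.properEneq join_subG Phi_sub commg_subl nXZ !andbT.
apply/eqP => E; have := Phi_nongen E; rewrite genGid => ZX.
have : [~: Z, X] \proper Z.
  apply: (nil_comm_properl (pgroup_nil pX)) => //.
  by rewrite finset.subsetI fintype.subxx.
by rewrite ZX fintype.properxx.
Qed.

(** [D_2] maps into the Frattini subgroup of every finite p-quotient, so [K] is onto each of these,
    and it is closed. *)
Lemma frattini K : closed K -> is_subgroup K ->
  (forall x, exists2 y, K y & zassenhaus p G 2 (y^-1 * x)) -> K = setT.
Proof.
move=> cK sK KD; apply/seteqP; split=> // x _; apply: closed_pquotP => //.
move=> gT X f fX; have [Y [YX YP]] := pquot_image fX sK.
have [fM fin fsurj pX of1] := fX.
suff YE : Y :=: X by apply/YP; rewrite YE.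
have X2 z : zassenhaus p G 2 z -> f z \in 'Phi(X).
  have p0 := prime_gt0 p_prime.
  have ip : (1 <= (2 + p.-1) %/ p)%N by rewrite leq_divRL//; lia.
  move=> Dz; have := @pquot_zassenhaus_Phi _ _ _ fX 1 2 X isT ip isT
    (normal_refl _) (fun x _ => fin x) z Dz.
  suff -> : 'Phi(X) <*> [~: X, X] = 'Phi(X) by [].
  have XPhi : [~: X, X] \subset 'Phi(X) by rewrite (Phi_joing pX) joing_subl.
  exact/joing_idPl.
suff /Phi_nongen : 'Phi(X) <*> Y = X by rewrite genGid.
apply/eqP; rewrite finset.eqEsubset join_subG Phi_sub YX /=.
apply/fintype.subsetP => _ /fsurj[z <-]; have [y Ky Dyz] := KD z.
rewrite -(mulVKg y z) fM; apply: groupM.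
  by apply: (fintype.subsetP (joing_subr _ _)); apply/YP; exists y.
by apply: (fintype.subsetP (joing_subl _ _)); exact: X2.
Qed.

End FiniteQuotients.

(** * Images under continuous homomorphisms of compact groups *)

Section Images.
Local Open Scope group_scope.
Variables (G K : topGroupType) (f : G -> K).
Hypotheses (fc : continuous f) (fM : {morph f : x y / x * y}).
Hypotheses (cG : compact [set: G]) (hK : hausdorff_space K).

(** For the inclusion from right to left, compactness of [G] makes the image of a closed subgroup
    closed. *)
Lemma cgen_image (A : set G) : f @` cgen A = cgen (f @` A).
Proof.
apply/seteqP; split.
  move=> _ [x Ax <-]; apply: (cgen_morph fc fM _ Ax) => y Ay.
  by apply: cgen_sub; exists y.
apply: cgen_min.
- apply: compact_closed => //; apply: continuous_compact.
    exact: continuous_subspaceT.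
  by apply: (subclosed_compact _ cG) => //; exact: cgen_closed.
- have [A1 AM AV] := cgen_subgroup A.
  have f1 : f 1 = 1 by apply: (@mulIg _ (f 1)); rewrite -fM !mul1g.
  split; first by exists 1.
    by move=> _ _ [x Ax <-] [y Ay <-]; exists (x * y); [exact: AM|exact: fM].
  by move=> _ [x Ax <-]; exists x^-1; [exact: AV|exact: gmorphV].
- by move=> _ [x Ax <-]; exists x => //; exact: cgen_sub.
Qed.

Lemma comm_subgroup_image (A B : set G) :
  comm_subgroup (f @` A) (f @` B) = f @` comm_subgroup A B.
Proof.
rewrite /comm_subgroup cgen_image; congr cgen; apply/seteqP; split=> z.
  move=> [_ [_ [[a Aa <-] [b Bb <-] ->]]]; exists [~ a, b].
    by exists a, b.
  exact: gmorphR.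
move=> [_ [a [b [Aa Bb ->]]] <-]; exists (f a), (f b).
by split; [exists a|exists b|exact: gmorphR].
Qed.

Lemma power_comm_image (A : set G) e :
  power_comm (f @` A) e = f @` power_comm A e.
Proof.
rewrite /power_comm cgen_image image_setU; congr (cgen (_ `|` _)).
  apply/seteqP; split=> z.
    by move=> [_ [x Ax <-] <-]; exists (x ^+ e); [exists x|exact: gmorphX].
  by move=> [_ [x Ax <-] <-]; exists (f x); [exists x|rewrite -(gmorphX e fM)].
apply/seteqP; split=> z.
  move=> [_ [_ [[a Aa <-] [b Bb <-] ->]]]; exists [~ a, b].
    by exists a, b.
  exact: gmorphR.
move=> [_ [a [b [Aa Bb ->]]] <-]; exists (f a), (f b).
by split; [exists a|exists b|exact: gmorphR].
Qed.

Lemma zassenhaus_image p i : f @` setT = setT ->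
  zassenhaus p K i = f @` zassenhaus p G i.
Proof.
move=> fT; apply/seteqP; split; last first.
  by move=> _ [x Dx <-]; exact: zassenhaus_morph.
rewrite /zassenhaus; move: {1 3}i => n; elim: n i => [|n IH] i /=.
  by rewrite fT.
case: ifP => _; first by rewrite fT.
rewrite cgen_image; apply: cgen_min; [exact: cgen_closed|exact: cgen_subgroup|].
rewrite image_setU.
move=> z [[_ /IH[x xD <-] <-]|[j /= ij zj]].
  by apply: cgen_sub; left; exists (x ^+ p); [exists x|rewrite gmorphX].
have : (f @` comm_subgroup (zassenhaus_rec p G n j)
    (zassenhaus_rec p G n (i - j))) z.
  rewrite -comm_subgroup_image; apply: cgen_min zj.
  - exact: cgen_closed.
  - exact: cgen_subgroup.
  move=> _ [a [b [/IH aj /IH bj ->]]]; apply: cgen_sub.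
  by exists a, b; split.
by move=> [y yj <-]; apply: cgen_sub; right; exists y => //; exists j.
Qed.

Lemma fin_idx_image (H N : set G) : fin_idx H N -> fin_idx (f @` H) (f @` N).
Proof.
move=> [s sH sP]; exists (map f s).
  by move=> _ /mapP[x /sH Hx ->]; exists x.
move=> _ [x /sP[t ts Nt] <-]; exists (f t); first exact: map_f.
by exists (t^-1 * x) => //; rewrite fM gmorphV.
Qed.

End Images.

(** * A finiteness criterion for abelian sections of pro-p groups *)

Section ProP.
Local Open Scope group_scope.
Variables (p : nat) (p_prime : prime p).

(* Modulo N and an open normal subgroup W, x^(p^t) vanishes for t large; the
   hypothesis allows a descent from t + 1 to t for t >= k, and N is the
   intersection of all N W. *)
Lemma section_torsion (G : topGroupType) (H N : set G) k :
  pro_group p G -> abelian_section H N -> closed H -> closed N ->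
  (forall x, H x ->
    exists2 y, N y & power_comm H (p ^ k.+1) (y^-1 * x ^+ (p ^ k))) ->
  forall x, H x -> N (x ^+ (p ^ k)).
Proof.
move=> proG HN cH cN HP x Hx; have [sH sN NH NR] := HN.
have [H1 HM HV] := sH; have [N1 NM NV] := sN.
apply: (closed_pquotP p_prime proG) => // gT X f fX.
have [fM fin fsurj pX of1] := fX.
pose B := [set z | H z /\ exists2 y, N y & f y = f z].
have NB : N `<=` B by move=> y Ny; split; [exact: NH|exists y].
have HB : abelian_section H B.
  split=> //; last 2 first.
  - by move=> y [].
  - by move=> y z Hy Hz; apply: NB; exact: NR.
  split; first exact: NB.
    move=> y z [Hy [u Nu fu]] [Hz [v Nv fv]]; split; first exact: HM.
    by exists (u * v); [exact: (NM)|rewrite !fM fu fv].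
  move=> y [Hy [u Nu fu]]; split; first exact: HV.
  by exists u^-1; [exact: NV|rewrite !(pquotV fX) fu].
have sB : is_subgroup B by case: HB.
have cB : closed B.
  have [Y [_ YP]] := pquot_image fX sN.
  rewrite (_ : B = H `&` f @^-1` [set` Y]).
    by apply: closedI => //; exact: (pquot_preimage_closed fX).
  by apply/seteqP; split=> y [Hy /YP].
suff h d : (forall x, H x -> B (x ^+ (p ^ (k + d)))) ->
    forall x, H x -> B (x ^+ (p ^ k)).
  have [T TE] := p_natP pX.
  have [] := h T _ x Hx; last by [].
  move=> y Hy; split; first exact: subgroupX.
  exists 1 => //; rewrite (pquot1 fX) (pquot_expg fX) expnD mulnC expgnA.
  by rewrite -TE expg_cardG ?expg1n.
elim: d => [|d IH]; first by rewrite addn0.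
move=> hd; apply: IH => y Hy; rewrite expnD expgnA.
pose S := [set z | H z /\ B (z ^+ (p ^ d))].
have [S1 SM SV] : is_subgroup S by exact: section_root_subgroup.
have SB : B `<=` S.
  by move=> z Bz; split; [by case: HB => _ _ + _; apply|exact: (@subgroupX _ B)].
have cS : closed S.
  apply: closedI => //.
  apply: (preimage_closed (f := fun z => z ^+ (p ^ d))) => //.
  by move=> z _; exact: expg_continuous.
have pS : power_comm H (p ^ k.+1) `<=` S.
  apply: cgen_min => //.
  move=> z [[u Hu <-]|[u [v [Hu Hv ->]]]].
    split; first exact: subgroupX.
    by rewrite -expgnA -expnD addSn -addnS; exact: hd.
  by apply: SB; apply: NB; exact: NR.
have [u Nu /pS Su] := HP _ Hy.
suff [_] : S (y ^+ (p ^ k)) by [].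
by rewrite -(mulVKg u (y ^+ _)); apply: (SM) => //; apply: SB; exact: NB.
Qed.

(** The hypothesis only concerns classes modulo [power_comm H (p ^ k.+1)], which is open when [H] is
    open in a finitely generated pro-p group; finiteness is then visible in a finite quotient. *)
Lemma section_fin_idx (G : topGroupType) (H N : set G) k :
  pro_group p G -> abelian_section H N -> closed H -> closed N -> fgen H ->
  (forall x, H x ->
    exists2 y, N y & power_comm H (p ^ k.+1) (y^-1 * x ^+ (p ^ k))) ->
  fin_idx H N.
Proof.
move=> proG HN cH cN fH HP.
apply: (fgen_torsion_fin_idx (e := p ^ k)) => //.
  by rewrite expn_gt0 prime_gt0.
exact: section_torsion HP.
Qed.

End ProP.

(** * Open subgroups and quotients of finitely generated pro-p groups *)

Section ProPOpen.
Local Open Scope group_scope.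
Variables (p : nat) (p_prime : prime p).

Lemma abelian_section_power_comm (G : topGroupType) (H : set G) e :
  is_subgroup H -> closed H -> abelian_section H (power_comm H e).
Proof.
move=> sH cH; split=> //; first exact: cgen_subgroup.
  apply: cgen_min => // z [[x Hx <-]|[x [y [Hx Hy ->]]]].
    exact: subgroupX.
  exact: subgroupR.
by move=> x y Hx Hy; apply: cgen_sub; right; exists x, y.
Qed.

Lemma abelian_section_comm (G : topGroupType) (H : set G) :
  is_subgroup H -> closed H -> abelian_section H (comm_subgroup H H).
Proof.
move=> sH cH; split=> //; first exact: cgen_subgroup.
  apply: cgen_min => // z [x [y [Hx Hy ->]]]; exact: subgroupR.
by move=> x y Hx Hy; apply: cgen_sub; exists x, y.
Qed.

Section FinitelyGenerated.
Variables (G : topGroupType) (proG : pro_group p G) (fG : fgen [set: G]).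

Let cG : compact [set: G]. Proof. by case: proG. Qed.

Lemma open_fgen (H : set G) : is_subgroup H -> open H -> fgen H.
Proof.
by move=> sH oH; apply: schreier => //; exact: open_fin_idx.
Qed.

Lemma section_open (H N : set G) e : open H -> abelian_section H N ->
  closed N -> (0 < e)%N -> (forall x, H x -> N (x ^+ e)) -> open N.
Proof.
move=> oH HN cN e0 He; have [sH sN NH _] := HN.
apply: (closed_fin_idx_open (oH) sN cN NH).
exact: fgen_torsion_fin_idx (open_fgen sH oH) e0 He.
Qed.

Lemma power_comm_open (H : set G) e : (0 < e)%N -> is_subgroup H -> open H ->
  open (power_comm H e).
Proof.
move=> e0 sH oH; have cH := open_subgroup_closed sH oH.
apply: (section_open (oH) (abelian_section_power_comm e sH cH) _ e0).
  exact: cgen_closed.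
by move=> x Hx; apply: cgen_sub; left; exists x.
Qed.

(** Each [D_i / D_(i+1)] is abelian, finitely generated and killed by [p], hence finite. *)
Lemma zassenhaus_open i : open (zassenhaus p G i).
Proof.
elim: i => [|i IH]; first exact: openT.
have [->|i0] := posnP i; first exact: openT.
have p1 := prime_gt1 p_prime.
apply: (section_open (e := p) IH) => //.
- split; [exact: zassenhaus_subgroup..|exact: zassenhausS|].
  move=> x y Dx Dy; rewrite zassenhausE//; apply: cgen_sub; right.
  exists 1%N => //=; apply: cgen_sub; exists x, y.
  by rewrite subn1.
- exact: zassenhaus_closed.
- exact: prime_gt0.
move=> x Dx; rewrite zassenhausE//; apply: cgen_sub; left; exists x => //.
apply: zassenhaus_antimono Dx.
by rewrite -ltnS ltn_divLR; nia.
Qed.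

End FinitelyGenerated.

(** Distinct classes of [x] and [y] are separated by a finite quotient of [G] where [x^-1 y] stays
    outside the image of [N]. The index of a basic subgroup [M] is read off from the finite quotient
    of [G] by the preimage of [M], which factors through [quot N]. *)
Lemma quot_pro (G : sigmaGroupType) (N : sigmaNormal G) :
  pro_group p G -> closed (nset N) -> pro_group p (quot N).
Proof.
move=> proG cN; have [cG hG _] := proG; have [[N1 NM NV] NJ] := nset_normal N.
have piM := @quot_piM G N.
split.
- have -> : [set: quot N] = quot_pi N @` [set: G].
    apply/seteqP; split=> // u _; exists (generic_quotient.repr u) => //.
    exact: quot_reprK.
  apply: continuous_compact => //; apply: continuous_subspaceT.
  exact: quot_pi_continuous.
- rewrite open_hausdorff => u v uv.
  have [x xE] : exists x, quot_pi N x = u.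
    by exists (generic_quotient.repr u); exact: quot_reprK.
  have [y yE] : exists y, quot_pi N y = v.
    by exists (generic_quotient.repr v); exact: quot_reprK.
  have nN : ~ nset N (x^-1 * y).
    by move=> /quot_piP; rewrite xE yE => uvE; rewrite uvE eqxx in uv.
  have [gT [X [f [fX fN]]]] : exists (gT : finGroupType) (X : {group gT})
      (f : G -> gT), pquot p X f /\
      ~ exists2 n, nset N n & f n = f (x^-1 * y).
    apply: contrapT => h; apply: nN; apply: (closed_pquotP p_prime proG) => //.
    move=> gT X f fX; apply: contrapT => fN; apply: h.
    by exists gT, X, f.
  have [fM _ _ _ _] := fX.
  exists (quot_pi N @` (f @^-1` [set f x]), quot_pi N @` (f @^-1` [set f y])) => /=.
    split; rewrite inE; first by exists x.
    by exists y.
  split=> /=; [apply: quot_pi_open; exact: (pquot_preimage_open fX)..|].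
  apply/eqP/seteqP; split=> // w [[a /= fa <-] [b /= fb /quot_piP Nba]].
  apply: fN; exists (b^-1 * a)^-1; first exact: NV.
  by rewrite invgM invgK !(pquotMV fX) fa fb.
- move=> U U1; have : nbhs 1 (quot_pi N @^-1` U).
    by apply: (@quot_pi_continuous _ N 1).
  move=> /(pquot_nbhs p_prime proG)[gT [X [f [fX fU]]]].
  have [fM fin fsurj pX of1] := fX.
  have [[k1 kM kV] kJ] := pquot_kernel_normal fX.
  pose M := quot_pi N @` (f @^-1` [set 1]).
  have oM : open M by exact: quot_pi_open.
  have nM : is_normal M.
    split; first split.
    + by exists 1.
    + move=> _ _ [a ka <-] [b kb <-]; rewrite -piM; exists (a * b) => //.
      exact: kM.
    + move=> _ [a ka <-]; exists a^-1; first exact: kV.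
      exact: (gmorphV (f := quot_pi N)).
    move=> _ g [a ka <-]; rewrite -(quot_reprK g).
    exists (a ^ (generic_quotient.repr g)).
      exact: kJ.
    by rewrite /conjg !piM (gmorphV piM).
  exists M; split=> //; first by move=> _ [a /fU ka <-].
  have nN' : is_normal [set x | M (quot_pi N x)].
    have [sM MJ] := nM; split; first exact: preimage_subgroup.
    by move=> x g /= Mx; rewrite /conjg !piM (gmorphV piM); exact: MJ.
  have oN' : open [set x | M (quot_pi N x)].
    by move: oM => /quot_openP.
  have [gT' [X' [f' [fX' kf']]]] := pquot_open_normal p_prime proG oN' nN'.
  have [f'M f'in f'surj pX' of1'] := fX'.
  have f'N x : nset N x -> f' x = 1.
    move=> Nx; have : [set x | M (quot_pi N x)] x; last by rewrite -kf'.
    exists 1; first exact: k1.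
    by apply/quot_piP; rewrite invg1 mul1g.
  pose g (u : quot N) := f' (generic_quotient.repr u).
  have gE x : g (quot_pi N x) = f' x.
    have /quot_piP/f'N := quot_reprK (quot_pi N x).
    by rewrite (pquotMV fX') => /mulg1_eq; rewrite invgK.
  have kg : g @^-1` [set 1] = M.
    apply/seteqP; split=> u; elim/quot_ind: u => x /=; rewrite gE => h.
      have : (f' @^-1` [set 1]) x by [].
      by rewrite kf'.
    by have : [set x | M (quot_pi N x)] x by []; rewrite -kf'.
  rewrite -kg; apply: (@pquot_index _ _ _ X').
  split=> //; last by rewrite kg.
  + by elim/quot_ind=> x; elim/quot_ind=> y; rewrite -piM !gE f'M.
  + by move=> u; exact: f'in.
  + by move=> y /f'surj[x <-]; exists (quot_pi N x).
Qed.

End ProPOpen.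

(** * Free pro-p groups and the space of weak Schur groups *)

Section FreeGenerators.
Local Open Scope group_scope.
Variables (p : nat) (p_prime : prime p).

Lemma closed_setM (G : topGroupType) (A B : set G) :
  compact [set: G] -> hausdorff_space G -> closed A -> closed B ->
  closed [set x | exists2 y, A y & B (y^-1 * x)].
Proof.
move=> cG hG cA cB.
rewrite (_ : [set _ | _] = (fun z : G * G => z.1 * z.2) @` (A `*` B)).
  apply: compact_closed => //; apply: continuous_compact.
    by apply: continuous_subspaceT; exact: mulg_continuous.
  by apply: compact_setX; apply: (subclosed_compact _ cG).
apply/seteqP; split=> x.
  by move=> [y Ay Byx]; exists (y, y^-1 * x) => //=; rewrite mulVKg.
by move=> [[y z] /= [Ay Bz] <-]; exists y; rewrite // mulKg.
Qed.

Lemma presented_pro n (F : freeSigmaPro p n) (r : n.-tuple (minusT F)) :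
  pro_group p (presented r).
Proof.
apply: quot_pro => //; first exact: free_pro.
exact: cgen_closed.
Qed.

Lemma free_gen_minus n (F : freeSigmaPro p n) (i : 'I_n) :
  free_gen F i \in minus_part F.
Proof. by rewrite inE; exact: free_sigma. Qed.

(** The projection of [F] modulo the normal closure of the generators and the trivial map agree on
    generators; uniqueness shows that this normal closure is [F]. As [x_i ^ g] is [x_i] times a
    commutator, the generators already generate [F] modulo [D_2], and the Frattini argument
    applies. *)
Lemma free_cgen n (F : freeSigmaPro p n) :
  [set: F] = cgen (range (free_gen F)).
Proof.
have proF := free_pro F; have [cF hF _] := proF.
pose r : n.-tuple (minusT F) :=
  [tuple exist _ (free_gen F i) (free_gen_minus F i) | i < n].
have rE i : set_val (tnth r i) = free_gen F i by rewrite tnth_mktuple.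
have relT x : relators r x.
  have [f [_ fU]] :=
    free_univ F (fun _ : 'I_n => (1 : presented r)) (presented_pro r).
  have f1 : f = quot_pi (relatorsN r).
    apply: fU; split; [exact: quot_pi_continuous|exact: quot_piM|move=> i].
    apply/quot_piP; rewrite mulg1.
    have [_ _ RV] : is_subgroup (relators r) by exact: cgen_subgroup.
    by apply: RV; apply: cgen_sub; exists i, 1; rewrite rE conjg1.
  have f2 : f = cst 1.
    apply: fU; split=> //; first exact: cst_continuous.
    by move=> a b /=; rewrite mulg1.
  have : quot_pi (relatorsN r) 1 = quot_pi (relatorsN r) x.
    by rewrite -f1 f2.
  by move=> /quot_piP; rewrite invg1 mul1g.
apply/esym/(frattini p_prime proF); [exact: cgen_closed|exact: cgen_subgroup|].
set K := cgen _; pose S := [set x | exists2 y, K y & zassenhaus p F 2 (y^-1 * x)].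
suff : relators r `<=` S by move=> RS x; exact: RS.
have [K1 KM KV] : is_subgroup K by exact: cgen_subgroup.
have [D1 DM DV] := zassenhaus_subgroup p F 2.
have DJ := @zassenhaus_conj p F 2.
apply: cgen_min.
- by apply: closed_setM => //; [exact: cgen_closed|exact: zassenhaus_closed].
- split.
  + by exists 1 => //; rewrite invg1 mul1g.
  + move=> x y [a Ka Dax] [b Kb Dby]; exists (a * b); first exact: KM.
    have -> : (a * b)^-1 * (x * y) = (a^-1 * x) ^ b * (b^-1 * y).
      by rewrite /conjg invgM -!mulgA mulVKg.
    by apply: DM => //; exact: DJ.
  + move=> x [a Ka Dax]; exists a^-1; first exact: KV.
    have := DJ _ a^-1 (DV _ Dax).
    by rewrite /conjg invgM !invgK !mulgA mulgK.
- move=> _ [i [g ->]]; rewrite rE; exists (free_gen F i).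
    by apply: cgen_sub; exists i.
  rewrite -commgEl zassenhausE//; apply: cgen_sub; right; exists 1%N => //.
  by apply: cgen_sub; exists (free_gen F i), g.
Qed.

Lemma cgen_range_fgen (G : topGroupType) n (y : 'I_n -> G) :
  [set: G] = cgen (range y) -> fgen [set: G].
Proof.
move=> ->; exists (codom y); congr cgen; apply/seteqP; split=> x.
  by move=> [i _ <-]; exact: codom_f.
by move=> /codomP[i ->]; exists i.
Qed.

Lemma free_fgen n (F : freeSigmaPro p n) : fgen [set: F].
Proof. exact: cgen_range_fgen (free_cgen F). Qed.

Lemma free_onto n (F : freeSigmaPro p n) (G : topGroupType) (y : 'I_n -> G) :
  pro_group p G -> [set: G] = cgen (range y) ->
  exists f : F -> G,
    [/\ continuous f, {morph f : a b / a * b} & f @` [set: F] = [set: G]].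
Proof.
move=> proG yG; have [f [[fc fM fy] _]] := free_univ F y proG.
exists f; split=> //; have [cF _ _] := free_pro F; have [_ hG _] := proG.
rewrite [in LHS]free_cgen (cgen_image fc fM cF hG) yG; congr cgen.
apply/seteqP; split=> z.
  by move=> [_ [i _ <-] <-]; exists i.
by move=> [i _ <-]; exists (free_gen F i) => //; exists i.
Qed.

Lemma presented_cgen n (F : freeSigmaPro p n) (r : n.-tuple (minusT F)) :
  [set: presented r] =
    cgen (range (fun i => quot_pi (relatorsN r) (free_gen F i))).
Proof.
have [cF _ _] := free_pro F; have [_ hG _] := presented_pro r.
have -> : range (fun i => quot_pi (relatorsN r) (free_gen F i)) =
    quot_pi (relatorsN r) @` range (free_gen F).
  apply/seteqP; split=> z.
    by move=> [i _ <-]; exists (free_gen F i) => //; exists i.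
  by move=> [_ [i _ <-] <-]; exists i.
rewrite -(cgen_image (@quot_pi_continuous _ _) (@quot_piM _ _) cF hG) -free_cgen.
apply/esym/seteqP; split=> // u _.
by exists (generic_quotient.repr u) => //; exact: quot_reprK.
Qed.

Lemma presented_fgen n (F : freeSigmaPro p n) (r : n.-tuple (minusT F)) :
  fgen [set: presented r].
Proof. exact: cgen_range_fgen (presented_cgen r). Qed.

Lemma zquot_pro (G : sigmaGroupType) j : pro_group p G ->
  pro_group p (zquot p G j).
Proof. by move=> proG; apply: quot_pro => //; exact: zassenhaus_closed. Qed.

(** By the Frattini argument, any lifts of generators modulo [D_j] generate. Hence all groups in a
    basic neighbourhood are quotients of one free group. *)
Lemma zquot_iso_cgen (G K : sigmaGroupType) n (y : 'I_n -> G) j :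
  pro_group p G -> pro_group p K -> (2 <= j)%N ->
  [set: G] = cgen (range y) -> sigma_iso (zquot p G j) (zquot p K j) ->
  exists z : 'I_n -> K, [set: K] = cgen (range z).
Proof.
move=> proG proK j2 yG [h [h' [[hc hM _] _ _ h'h]]].
pose piG := quot_pi (zassenhausN p G j); pose piK := quot_pi (zassenhausN p K j).
have /choice[z zP] (i : 'I_n) : exists z, piK z = h (piG (y i)).
  by exists (generic_quotient.repr (h (piG (y i)))); exact: quot_reprK.
have [cG hG _] := proG; have [cK hK _] := proK.
have [cGj hGj _] := zquot_pro j proG; have [_ hKj _] := zquot_pro j proK.
exists z; apply/esym/(frattini p_prime proK).
- exact: cgen_closed.
- exact: cgen_subgroup.
move=> x; have [w wE] : exists w, piG w = h' (piK x).
  by exists (generic_quotient.repr (h' (piK x))); exact: quot_reprK.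
have : (piK @` cgen (range z)) (piK x).
  rewrite (cgen_image (@quot_pi_continuous _ _) (@quot_piM _ _) cK hKj).
  rewrite -(h'h (piK x)) -wE.
  have : [set: G] w by [].
  rewrite yG; apply: (cgen_morph (f := fun w => h (piG w))).
  - by move=> a; apply: continuous_comp; [exact: quot_pi_continuous|exact: hc].
  - by move=> a b; rewrite /piG quot_piM hM.
  by move=> _ [i _ <-]; apply: cgen_sub; exists (z i) => //; exists i.
move=> [v Kv /quot_piP Dvx]; exists v => //.
exact: zassenhaus_antimono Dvx.
Qed.

End FreeGenerators.

(** * The strong classes as a countable intersection of open sets *)

Section SchurSpace.
Local Open Scope group_scope.
Variables (p : nat) (p_prime : prime p).

Definition zassenhaus_ab_finite (G : topGroupType) i :=
  fin_idx (zassenhaus p G i)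
    (comm_subgroup (zassenhaus p G i) (zassenhaus p G i)).

Lemma comm_subgroupS (G : topGroupType) (A A' B B' : set G) :
  A `<=` A' -> B `<=` B' -> comm_subgroup A B `<=` comm_subgroup A' B'.
Proof.
move=> AA BB; apply: cgen_min; [exact: cgen_closed|exact: cgen_subgroup|].
move=> _ [x [y [Ax By ->]]]; apply: cgen_sub; exists x, y.
by split; [exact: AA|exact: BB|].
Qed.

(** An open [H] contains some [D_i] with finite index, and [[D_i, D_i]] lies in [[H, H]]. The
    countable family of the [D_i] can therefore replace all open subgroups. *)
Lemma strong_ab_finiteP (G : topGroupType) : pro_group p G -> fgen [set: G] ->
  (forall H : set G, open H -> is_subgroup H -> finite_abelianization H) <->
  (forall i, zassenhaus_ab_finite G i).
Proof.
move=> proG fG; have [cG hG _] := proG; split=> [hab i|hab H oH sH].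
  apply/fin_idxP; [exact: zassenhaus_subgroup|exact: cgen_subgroup|].
  by apply: hab; [exact: zassenhaus_open|exact: zassenhaus_subgroup].
apply/fin_idxP => //; first exact: cgen_subgroup.
have [H1 _ _] := sH.
have [i i0 iH] := zassenhaus_nbhs p_prime proG (open_nbhs_nbhs (conj oH H1)).
have sD := zassenhaus_subgroup p G i.
have oD := zassenhaus_open p_prime proG fG i.
apply: (@fin_idxS _ _ (comm_subgroup (zassenhaus p G i) (zassenhaus p G i))).
  exact: comm_subgroupS.
apply: fin_idx_trans (hab i) => //.
by apply: (fin_idx_sub (subsetT H)) => //; exact: open_fin_idx.
Qed.

Lemma zassenhaus_ab_finite_iso (G K : sigmaGroupType) i :
  pro_group p G -> pro_group p K -> sigma_iso G K ->
  zassenhaus_ab_finite G i -> zassenhaus_ab_finite K i.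
Proof.
move=> [cG _ _] [_ hK _] [f [g [[fc fM _] _ fg gf]]].
have fT : f @` setT = setT.
  by apply/seteqP; split=> // x _; exists (g x).
rewrite /zassenhaus_ab_finite (zassenhaus_image fc fM cG hK p i fT).
by rewrite (comm_subgroup_image fc fM cG hK); exact: fin_idx_image.
Qed.

Lemma open_section_exponent (G : topGroupType) (N : set G) :
  pro_group p G -> open N -> is_subgroup N ->
  exists k, forall x, N (x ^+ (p ^ k)).
Proof.
move=> proG oN [N1 _ _].
have [gT [X [f [fX fN]]]] :=
  pquot_nbhs p_prime proG (open_nbhs_nbhs (conj oN N1)).
have [_ fin _ pX _] := fX; have [k kE] := p_natP pX.
exists k => x; apply: fN; rewrite /= (pquot_expg fX) -kE.
by rewrite expg_cardG.
Qed.

(** One level [j] has to serve every [K]. It is chosen in [F], where [D_j] lies in the open subgroup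
    [D_i^(p^(k+1)) [D_i, D_i]]; surjections from [F] carry this inclusion to all [K]. *)
Lemma zassenhaus_ab_finite_locally n (F : freeSigmaPro p n)
    (G : sigmaGroupType) (y : 'I_n -> G) i :
  pro_group p G -> [set: G] = cgen (range y) -> zassenhaus_ab_finite G i ->
  exists2 j, (2 <= j)%N & forall K : sigmaGroupType, pro_group p K ->
    sigma_iso (zquot p K j) (zquot p G j) -> zassenhaus_ab_finite K i.
Proof.
move=> proG yG fabG; have fG := cgen_range_fgen yG.
have proF := free_pro F; have [cF _ _] := proF; have [cG hG _] := proG.
set H := zassenhaus p G i.
have sH : is_subgroup H by exact: zassenhaus_subgroup.
have cH : closed H by exact: zassenhaus_closed.
have oH : open H by exact: zassenhaus_open.
have [_ sN NH _] := abelian_section_comm sH cH.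
have oN := closed_fin_idx_open oH sN (@cgen_closed _ _) NH fabG.
have [k kN] := open_section_exponent proG oN sN.
have sHF := zassenhaus_subgroup p F i.
have oHF := zassenhaus_open p_prime proF (free_fgen p_prime F) i.
have pk0 : (0 < p ^ k.+1)%N by rewrite expn_gt0 prime_gt0.
have oP := power_comm_open proF (free_fgen p_prime F) pk0 sHF oHF.
have [P1 _ _] : is_subgroup (power_comm (zassenhaus p F i) (p ^ k.+1)).
  exact: cgen_subgroup.
have [j0 j00 j0P] := zassenhaus_nbhs p_prime proF (open_nbhs_nbhs (conj oP P1)).
(* The bound [2] yields generators of [K], and the bound [i] lets elements of [D_i] be lifted
   through the quotients by [D_j]. *)
pose j := maxn 2 (maxn i j0); exists j; first by rewrite leq_maxl.
have ij : (i <= j)%N by rewrite !leq_max leqnn orbT.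
have j0j : (j0 <= j)%N by rewrite !leq_max leqnn !orbT.
move=> K proK isoKG; have [cK hK _] := proK.
have [z zK] := zquot_iso_cgen p_prime proG proK (leq_maxl _ _) yG
  (sigma_iso_sym isoKG).
have [f [fc fM fT]] := free_onto p_prime F proK zK.
have DjK : zassenhaus p K j `<=` power_comm (zassenhaus p K i) (p ^ k.+1).
  rewrite !(zassenhaus_image fc fM cF hK _ _ fT) (power_comm_image fc fM cF hK).
  apply: image_subset; apply: subset_trans j0P; exact: zassenhaus_antimono.
have sHK := zassenhaus_subgroup p K i.
have cHK := @zassenhaus_closed p K i.
apply: (section_fin_idx p_prime proK (abelian_section_comm sHK cHK) cHK (k := k)).
- exact: cgen_closed.
- have fK := cgen_range_fgen zK.
  by apply: (open_fgen proK) => //; exact: zassenhaus_open.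
move=> x Dx.
have [h [h' [[hc hM _] [h'c h'M _] hh' h'h]]] := isoKG.
pose piG := quot_pi (zassenhausN p G j); pose piK := quot_pi (zassenhausN p K j).
have piGc : continuous piG by exact: quot_pi_continuous.
have piKc : continuous piK by exact: quot_pi_continuous.
have piGM : {morph piG : x y / x * y} by exact: quot_piM.
have piKM : {morph piK : x y / x * y} by exact: quot_piM.
have hpi a : zassenhaus p K i a -> exists2 b, H b & piG b = h (piK a).
  move=> Da; have : zassenhaus p (zquot p G j) i (h (piK a)).
    apply: (zassenhaus_morph hc hM); exact: (zassenhaus_morph piKc piKM).
  by move=> /(zquot_zassenhaus ij).
have h'pi a : H a -> exists2 b, zassenhaus p K i b & piK b = h' (piG a).
  move=> Da; have : zassenhaus p (zquot p K j) i (h' (piG a)).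
    apply: (zassenhaus_morph h'c h'M); exact: (zassenhaus_morph piGc piGM).
  by move=> /(zquot_zassenhaus ij).
have [w Hw wx] := hpi _ Dx.
have [_ hKj _] := zquot_pro p_prime j proK.
(* In [G], [w^(p^k)] lies in [[D_i, D_i]]. Carried over to [K / D_j], this gives an element of
   [[D_i, D_i]] in [K] that agrees with [x^(p^k)] modulo [D_j]. *)
have : (piK @` comm_subgroup (zassenhaus p K i) (zassenhaus p K i))
    (h' (piG (w ^+ (p ^ k)))).
  rewrite -(comm_subgroup_image piKc piKM cK hKj).
  have := kN w; apply: (cgen_morph (f := fun a => h' (piG a))).
  - by move=> a; apply: continuous_comp; [exact: piGc|exact: h'c].
  - by move=> a b; rewrite /= piGM h'M.
  move=> _ [a [b [/h'pi[a' Da' a'E] /h'pi[b' Db' b'E] ->]]].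
  apply: cgen_sub; exists (piK a'), (piK b'); split; [by exists a'|by exists b'|].
  by rewrite a'E b'E -(gmorphR h'M) -(gmorphR piGM).
rewrite (gmorphX _ piGM) (gmorphX _ h'M) wx hh' -(gmorphX _ piKM).
move=> [v Nv /quot_piP Dv]; exists v => //; exact: DjK.
Qed.

Section Sch.
Variable F : forall n, freeSigmaPro p n.

Lemma schur_group_pro (c : Sch F) : pro_group p (schur_group c).
Proof. exact: presented_pro. Qed.

Lemma Sch_openP (A : set (Sch F)) :
  (forall c, A c -> exists2 i, (2 <= i)%N &
    schur_basic i (schur_group c) `<=` A) -> open A.
Proof.
move=> hA; pose D := [set U | schur_basis F U /\ U `<=` A].
have : \bigcup_(U in D) id U = A.
  apply/seteqP; split=> [c [U [_ UA] /UA]//|c Ac].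
  have [i i2 iA] := hA c Ac; exists (schur_basic i (schur_group c)).
    split=> //; exists i, (schur_group c); split=> //.
    exact: schur_group_weak.
  exact: sigma_iso_refl.
by move=> DA; exists D => // U [].
Qed.

Lemma Sch_ab_finite_open i :
  open [set c : Sch F | zassenhaus_ab_finite (schur_group c) i].
Proof.
apply: Sch_openP => c /= fc.
have [j j2 jP] := zassenhaus_ab_finite_locally (F _) (schur_group_pro c)
  (presented_cgen p_prime (tagged (generic_quotient.repr c))) fc.
exists j => // d /= dc; apply: jP => //; exact: schur_group_pro.
Qed.

Lemma Sch_strongE :
  Sch_strong F =
  \bigcap_i [set c : Sch F | zassenhaus_ab_finite (schur_group c) i].
Proof.
apply/seteqP; split=> c.
  move=> [_ /strong_ab_finiteP h] i _; apply: h; first exact: schur_group_pro.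
  exact: presented_fgen.
move=> h; split; first exact: schur_group_weak.
apply/strong_ab_finiteP; [exact: schur_group_pro|exact: presented_fgen|].
by move=> i; exact: h.
Qed.

Lemma Sch_strong_Gdelta : Gdelta (Sch_strong F).
Proof.
by exists (fun i => [set c : Sch F | zassenhaus_ab_finite (schur_group c) i]);
  [exact: Sch_ab_finite_open|exact: Sch_strongE].
Qed.

End Sch.
End SchurSpace.

(** * Integral pencils *)

Section Pencil.
Import GRing.Theory Num.Theory Order.TTheory.
Local Open Scope ring_scope.

(* Divided form of Lagrange interpolation for the leading coefficient. *)
Lemma dvdz_interpolation m (f : {poly int}) (z : seq int) (d C : int) :
  (size f <= m.+1)%N -> size z = m.+1 -> uniq z ->
  (forall x, x \in z -> (d %| f.[x])%Z) ->
  (forall x y, x \in z -> y \in z -> x != y -> (x - y %| C)%Z) ->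
  (d %| f`_m * C ^+ m)%Z.
Proof.
elim: m f z => [|m IH] f [|z0 z]//=.
  move=> sf _ _ df _; rewrite expr0 mulr1.
  by have := df z0 (mem_head _ _); rewrite {1}(size1_polyC sf) hornerC.
move=> sf [sz] /andP[z0z uz] df dC.
have /factor_theorem[g gE] : root (f - (f.[z0])%:P) z0.
  by rewrite /root !hornerE subrr.
have fE : f = g * ('X - z0%:P) + (f.[z0])%:P by rewrite -gE subrK.
have sg : (size g <= m.+1)%N.
  have [->|g0] := eqVneq g 0; first by rewrite size_poly0.
  have : (size (g * ('X - z0%:P))%R <= m.+2)%N.
    rewrite -gE; apply: leq_trans (size_polyD _ _) _.
    rewrite geq_max sf size_polyN.
    by apply: leq_trans (size_polyC_leq1 _) _.
  by rewrite size_Mmonic ?monicXsubC// size_XsubC addn2.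
have -> : f`_m.+1 = g`_m.
  rewrite fE coefD coefC addr0 mulrBr coefB coefMX coefMC /=.
  by rewrite [g`_m.+1]nth_default// mul0r subr0.
(* As [f(x) - f(z0) = g(x) (x - z0)] and [x - z0] divides [C], the polynomial [C g] is again
   divisible by [d] at the remaining points. *)
have -> : g`_m * C ^+ m.+1 = (C *: g)`_m * C ^+ m by rewrite coefZ exprS; ring.
apply: (IH (C *: g) z) => //.
- exact: leq_trans (size_scale_leq _ _) sg.
- move=> x xz; have xz0 : x != z0 by apply: contraNneq z0z => <-.
  have : (d %| f.[x] - f.[z0])%Z.
    by apply: rpredB; apply: df; rewrite inE ?eqxx ?xz ?orbT.
  rewrite {1}fE !hornerE addrK => h.
  have /dvdzP[q ->] : (x - z0 %| C)%Z.
    by apply: dC => //; rewrite inE ?eqxx ?xz ?orbT.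
  by rewrite -mulrA [(x - z0) * _]mulrC; exact: dvdz_mull.
- by move=> x y xz yz; apply: dC; rewrite inE ?xz ?yz orbT.
Qed.

Lemma char_poly_shift m (N : 'M[int]_m) (z : int) :
  (char_poly (- N)).[z] = \det (N + z%:M).
Proof.
rewrite /char_poly -horner_evalE -det_map_mx; congr (\det _).
apply/matrixP => i j; rewrite !mxE /= /horner_eval !hornerE.
by rewrite hornerMn hornerX opprK addrC.
Qed.

(** The determinant is a monic polynomial of degree [m] in the shift, and the differences of the
    shifts divide [e K!]. From [m + 1] zeros modulo [d], interpolation would make [d] divide the
    smaller positive number [(e K!)^m]. *)
Lemma card_singular_shifts m (N : 'M[int]_m) (e K d : nat) : (0 < e)%N ->
  ((e * K`!) ^ m < d)%N ->
  (#|[pred k : 'I_K | (d%:Z %| \det (N + (k * e)%N%:Z%:M))%Z]| <= m)%N.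
Proof.
move=> e0 dlt; rewrite leqNgt; apply/negP => hm.
set S := [pred k : 'I_K | _] in hm.
pose z := [seq (k * e)%N%:Z | k : 'I_K <- take m.+1 (enum S)].
have zP x : x \in z -> exists2 k : 'I_K, k \in S & x = (k * e)%N%:Z.
  move=> /mapP[k /mem_take]; rewrite mem_enum => kS ->; by exists k.
have := @dvdz_interpolation m (char_poly (- N)) z d (e * K`!)%N%:Z.
rewrite size_char_poly leqnn.
have -> : (char_poly (- N))`_m = 1.
  have := char_poly_monic (- N); rewrite monicE lead_coefE size_char_poly.
  by move/eqP.
rewrite mul1r => h.
have {}h : (d%:Z %| (e * K`!)%N%:Z ^+ m)%Z.
  apply: h => //.
  - by rewrite size_map size_takel// -cardE.
  - rewrite map_inj_uniq ?take_uniq ?enum_uniq//.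
    by move=> i j [] /eqP; rewrite eqn_pmul2r// => /eqP/val_inj.
  - by move=> x /zP[k kS ->]; rewrite char_poly_shift.
  - move=> _ _ /zP[k _ ->] /zP[l _ ->] kl.
    rewrite dvdzE; set D := (`|_|)%N.
    have -> : D = (`|k%:Z - l%:Z| * e)%N.
      by rewrite /D !PoszM -mulrBl abszM.
    rewrite absz_nat mulnC dvdn_pmul2l//; apply: dvdn_fact.
    have kl' : (k : nat) != l by apply: contraNneq kl => ->.
    have := ltn_ord k; have := ltn_ord l; lia.
move: h; rewrite dvdzE abszX absz_nat => /dvdn_leq.
by rewrite expn_gt0 muln_gt0 e0 fact_gt0 => /(_ isT); rewrite leqNgt dlt.
Qed.

Section Module.
Variables (V : zmodType) (T : finType).

Definition int_span (B : T -> V) : set V :=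
  [set v | exists c : T -> int, v = \sum_t B t *~ c t].

Variables (B : T -> V).

Lemma int_span0 : int_span B 0.
Proof. by exists (fun=> 0); rewrite big1. Qed.

Lemma int_spanD u v : int_span B u -> int_span B v -> int_span B (u + v).
Proof.
move=> [c ->] [d ->]; exists (fun t => c t + d t).
by rewrite -big_split; apply: eq_bigr => t _; rewrite mulrzDr.
Qed.

Lemma int_spanZ u c : int_span B u -> int_span B (u *~ c).
Proof.
move=> [d ->]; exists (fun t => d t * c).
by rewrite mulrz_suml; apply: eq_bigr => t _; rewrite mulrzA.
Qed.

Lemma int_span_sum (I : finType) (u : I -> V) : (forall i, int_span B (u i)) ->
  int_span B (\sum_i u i).
Proof.
by move=> h; apply: (big_ind (int_span B)) => //; [exact: int_span0|exact: int_spanD].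
Qed.

Lemma int_span_mem t : int_span B (B t).
Proof.
exists (fun u => (u == t)%:R); rewrite (bigD1 t)//= eqxx mulr1z big1 ?addr0//.
by move=> u /negbTE ->.
Qed.
End Module.

(* With X U = e and X A = N on coordinate vectors, X (A + k U) = N + k e, so
   det (N + k e) annihilates V modulo the span of A + k U; as p^s also does, so
   does p^(s-1) unless p^s divides this determinant. *)
Lemma card_bad_pencil (V : zmodType) (T : finType) m (h : 'I_m -> V)
    (p e s K : nat) (A U : T -> V) :
  prime p -> (0 < e)%N -> ((e * K`!) ^ m < p ^ s)%N ->
  (forall v, int_span h v) ->
  (forall v : V, v *+ (p ^ s)%N = 0) -> (forall v, int_span U (v *+ e)) ->
  (#|[pred k : 'I_K | ~~ `[< forall v,
      int_span (fun t => A t + U t *+ k)%R (v *+ (p ^ s.-1)%N)%R >]]| <= m)%N.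
Proof.
move=> p_prime e0 lt_s hspan ps0 Uspan.
have /choice[X XE] (j : 'I_m) := Uspan (h j).
have /choice[al alE] (t : T) := hspan (A t).
pose N : 'M[int]_m := \matrix_(j, l) \sum_t X j t * al t l.
apply: leq_trans (card_singular_shifts N e0 lt_s).
apply: subset_leq_card; apply/fintype.subsetP => k; rewrite !inE.
apply: contraNT => ndet; apply/asboolP => v.
set S := int_span _.
have s0 : (0 < s)%N.
  case: (posnP s) lt_s => // ->; rewrite expn0 ltnS leqn0 expn_eq0 muln_eq0.
  by rewrite eqn0Ngt e0 eqn0Ngt fact_gt0.
set M := N + _ in ndet.
have row j : S (\sum_l h l *~ M j l).
  have -> : \sum_l h l *~ M j l = \sum_t (A t + U t *+ k) *~ X j t.
    under eq_bigr do rewrite mxE mulrzDr.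
    rewrite big_split /=.
    under [RHS]eq_bigr do rewrite mulrzDl.
    rewrite big_split /=; congr (_ + _).
      under eq_bigr do rewrite mxE mulrz_sumr.
      rewrite exchange_big; apply: eq_bigr => t _.
      rewrite alE mulrz_suml; apply: eq_bigr => l _.
      by rewrite -mulrzA mulrC.
    rewrite (bigD1 j)//= big1 ?addr0; last first.
      by move=> l lj; rewrite mxE eq_sym (negbTE lj).
    rewrite mxE eqxx mulr1n.
    have -> : \sum_t (U t *+ k) *~ X j t = (\sum_t U t *~ X j t) *+ k.
      by rewrite -sumrMnl; apply: eq_bigr => t _; rewrite !pmulrn -!mulrzA mulrC.
    by rewrite -XE -mulrnA mulnC.
  by apply: int_span_sum => t; apply: int_spanZ; exact: int_span_mem.
have deth i : S (h i *~ \det M).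
  have -> : h i *~ \det M = \sum_j (\sum_l h l *~ M j l) *~ (\adj M) i j.
    under eq_bigr do rewrite mulrz_suml.
    rewrite exchange_big /=.
    have E l : \sum_j h l *~ M j l *~ (\adj M) i j = h l *~ ((\det M)%:M i l).
      rewrite -mul_adj_mx mxE mulrz_sumr; apply: eq_bigr => j _.
      by rewrite -mulrzA mulrC.
    rewrite (eq_bigr _ (fun l _ => E l)) (bigD1 i)//= big1 ?addr0.
      by rewrite mxE eqxx.
    by move=> l li; rewrite mxE eq_sym (negbTE li).
  by apply: int_span_sum => j; exact: int_spanZ (row j).
(* Since [p^s] does not divide the determinant, their gcd is some [p^f] with [f < s], which divides
   [p^(s-1)]. *)
have [u [w uw]] : exists u w, (p ^ s.-1)%N%:Z = u * (p ^ s)%N%:Z + w * \det M.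
  have [u [w uwE]] := Bezoutz (p ^ s)%N%:Z (\det M).
  have : (gcdn (p ^ s) `|\det M| %| p ^ s)%N by exact: dvdn_gcdl.
  move=> /(dvdn_pfactor _ _ p_prime)[f fs gE].
  have fs' : (f < s)%N.
    rewrite ltn_neqAle fs andbT; apply: contra ndet => /eqP fE.
    by rewrite dvdzE absz_nat -fE -gE dvdn_gcdr.
  exists (u * (p ^ (s.-1 - f))%N%:Z), (w * (p ^ (s.-1 - f))%N%:Z).
  have -> : (p ^ s.-1)%N = (gcdn (p ^ s) `|\det M| * p ^ (s.-1 - f))%N.
    by rewrite gE -expnD subnKC// -ltnS prednK.
  rewrite PoszM -[(gcdn _ _)%:Z]/(gcdz (p ^ s)%N%:Z (\det M)) -uwE; ring.
have psh i : S (h i *+ (p ^ s.-1)%N).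
  rewrite pmulrn uw mulrzDr [u * _]mulrC [w * _]mulrC !mulrzA.
  rewrite -[_ *~ (p ^ s)%N%:Z]pmulrn ps0 mul0rz add0r.
  exact: int_spanZ (deth i).
have [c ->] := hspan v.
rewrite -sumrMnl; apply: int_span_sum => i.
rewrite pmulrn -mulrzA mulrC mulrzA -pmulrn; exact: int_spanZ (psh i).
Qed.

End Pencil.

(** * Generic generation of the quotients of H *)

Section CommutingSubgroup.
Local Open Scope group_scope.

(** Commutativity is packaged to give the subgroup a [zmodType] structure, where sums and integer
    matrices act. *)
Record commSubgroup (Q : topGroupType) := CommSubgroup {
  comm_set :> set Q;
  comm_set_subgroup : is_subgroup comm_set;
  comm_setC : forall x y, comm_set x -> comm_set y -> x * y = y * x
}.

Variables (Q : topGroupType) (A : commSubgroup Q).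

Definition comm_zmod : Type := set_type (comm_set A).

HB.instance Definition _ := Choice.on comm_zmod.

Definition cval (u : comm_zmod) : Q := set_val u.

Lemma cvalP u : comm_set A (cval u). Proof. exact: (set_valP u). Qed.

Lemma cval_inj : injective cval. Proof. exact: val_inj. Qed.

Definition cmk x (Ax : comm_set A x) : comm_zmod := exist _ x (mem_set Ax).

Lemma cmkK x (Ax : comm_set A x) : cval (cmk Ax) = x. Proof. by []. Qed.

Let A1 : comm_set A 1. Proof. by case: (comm_set_subgroup A). Qed.
Let AM x y : comm_set A x -> comm_set A y -> comm_set A (x * y).
Proof. by case: (comm_set_subgroup A) => _ + _; apply. Qed.
Let AV x : comm_set A x -> comm_set A x^-1.
Proof. by case: (comm_set_subgroup A) => _ _; apply. Qed.

Definition cadd (u v : comm_zmod) := cmk (AM (cvalP u) (cvalP v)).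
Definition copp (u : comm_zmod) := cmk (AV (cvalP u)).
Definition czero := cmk A1.

Fact caddA : associative cadd.
Proof. by move=> u v w; apply: cval_inj; rewrite !cmkK mulgA. Qed.
Fact caddC : commutative cadd.
Proof.
by move=> u v; apply: cval_inj; rewrite !cmkK (comm_setC (cvalP u) (cvalP v)).
Qed.
Fact cadd0 : left_id czero cadd.
Proof. by move=> u; apply: cval_inj; rewrite !cmkK mul1g. Qed.
Fact caddN : left_inverse czero copp cadd.
Proof. by move=> u; apply: cval_inj; rewrite !cmkK mulVg. Qed.

HB.instance Definition _ :=
  GRing.isZmodule.Build comm_zmod caddA caddC cadd0 caddN.

Lemma cvalD (u v : comm_zmod) : cval (u + v)%R = cval u * cval v.
Proof. by []. Qed.

Lemma cvalN (u : comm_zmod) : cval (- u)%R = (cval u)^-1. Proof. by []. Qed.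

Lemma cvalMn (u : comm_zmod) n : cval (u *+ n)%R = cval u ^+ n.
Proof.
elim: n => [|n IH]; first by rewrite GRing.mulr0n expg0.
by rewrite GRing.mulrS cvalD IH expgS.
Qed.

(* junk value [0] outside the subgroup *)
Definition cproj (x : Q) : comm_zmod :=
  if pselect (comm_set A x) is left Ax then cmk Ax else 0%R.

Lemma cprojK x : comm_set A x -> cval (cproj x) = x.
Proof.
by move=> Ax; rewrite /cproj; case: pselect.
Qed.

Lemma cvalK u : cproj (cval u) = u.
Proof. by apply: cval_inj; rewrite cprojK//; exact: cvalP. Qed.

End CommutingSubgroup.

(** * The module [H / H^e [H, H]] and its transfer cocycle *)

Section Level.
Local Open Scope group_scope.
Import GRing.Theory.
Variables (p : nat) (p_prime : prime p) (G : sigmaGroupType).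
Variables (proG : pro_group p G) (H : sigmaNormal G) (oH : open (nset H)).
Variables (e : nat).

Let sH : is_subgroup H. Proof. by case: (nset_normal H). Qed.
Let HJ x g : nset H x -> nset H (x ^ g).
Proof. by case: (nset_normal H) => _; apply. Qed.
Let cH : closed H. Proof. exact: open_subgroup_closed. Qed.

Fact power_comm_normal : is_normal (power_comm H e).
Proof.
split=> [|x g]; first exact: cgen_subgroup.
apply: (cgen_morph (f := fun x => x ^ g)); first exact: conjg_continuous.
  by move=> ? ?; rewrite conjMg.
move=> z [[y Hy <-]|[a [b [Ha Hb ->]]]]; apply: cgen_sub.
  by left; exists (y ^ g); [exact: HJ|rewrite conjXg].
by right; exists (a ^ g), (b ^ g); rewrite conjRg; split=> //; exact: HJ.
Qed.

Fact power_comm_sigma x : power_comm H e x -> power_comm H e (sigma x).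
Proof.
apply: cgen_morph; [exact: sigma_continuous|exact: sigmaM|].
move=> z [[y Hy <-]|[a [b [Ha Hb ->]]]]; apply: cgen_sub.
  left; exists (sigma y); first exact: nset_sigma.
  by rewrite (gmorphX _ (@sigmaM G)).
right; exists (sigma a), (sigma b); rewrite (gmorphR (@sigmaM G)).
by split=> //; exact: nset_sigma.
Qed.

Definition power_commN := SigmaNormal power_comm_normal power_comm_sigma.

Let N := power_commN.
Let pi := quot_pi N.
Let piM : {morph pi : x y / x * y}. Proof. exact: quot_piM. Qed.

Let HN := abelian_section_power_comm e sH cH.

Fact quot_image_subgroup : is_subgroup (pi @` H).
Proof.
have [H1 HM HV] := sH; split; first by exists 1.
  by move=> _ _ [x Hx <-] [y Hy <-]; exists (x * y); [exact: HM|].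
by move=> _ [x Hx <-]; exists x^-1; [exact: HV|exact: gmorphV].
Qed.

Fact quot_image_comm u v : (pi @` H) u -> (pi @` H) v -> u * v = v * u.
Proof.
move=> [x Hx <-] [y Hy <-]; rewrite -!piM; apply/quot_piP.
have -> : (x * y)^-1 * (y * x) = [~ y, x] by rewrite /commg /conjg invgM !mulgA.
by case: HN => _ _ _; apply.
Qed.

(** [H / H^e [H, H]] is realised inside the quotient of the whole group [G], so that conjugation by
    [G] and [sigma] act on it. *)
Definition quot_image := CommSubgroup quot_image_subgroup quot_image_comm.

Let V := comm_zmod quot_image.

Definition emb (x : G) : V := cproj quot_image (pi x).

Lemma embK x : nset H x -> cval (emb x) = pi x.
Proof. by move=> Hx; rewrite cprojK//; exists x. Qed.

Lemma emb_onto v : exists2 x, nset H x & emb x = v.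
Proof.
have [x Hx xv] := cvalP v; exists x => //.
by apply: cval_inj; rewrite embK.
Qed.

Lemma emb_eqP x y : nset H x -> nset H y ->
  emb x = emb y <-> power_comm H e (x^-1 * y).
Proof.
move=> Hx Hy; split=> [/(congr1 (@cval _ _))|xy].
  by rewrite !embK// => /quot_piP.
by apply: cval_inj; rewrite !embK//; apply/quot_piP.
Qed.

Lemma embM x y : nset H x -> nset H y -> emb (x * y) = (emb x + emb y)%R.
Proof.
have [H1 HM HV] := sH; move=> Hx Hy; apply: cval_inj.
by rewrite cvalD !embK ?piM//; exact: HM.
Qed.

Lemma embV x : nset H x -> emb x^-1 = (- emb x)%R.
Proof.
have [H1 HM HV] := sH; move=> Hx; apply: cval_inj.
by rewrite cvalN !embK ?(gmorphV piM)//; exact: HV.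
Qed.

Lemma embX x n : nset H x -> emb (x ^+ n) = (emb x *+ n)%R.
Proof.
move=> Hx; apply: cval_inj.
by rewrite cvalMn !embK ?(gmorphX _ piM)//; exact: subgroupX.
Qed.

Lemma emb1 : emb 1 = 0%R.
Proof. by have [H1 _ _] := sH; apply: cval_inj; rewrite embK. Qed.

Lemma emb0 x : power_comm H e x -> emb x = 0%R.
Proof.
have [H1 _ _] := sH; move=> Nx; rewrite -emb1; apply/emb_eqP => //.
  by case: HN => _ _ + _; apply.
by rewrite mulg1; case: HN => _ [_ _ NV] _ _; exact: NV.
Qed.

Definition cj (g : G) (v : V) : V := cproj quot_image (cval v ^ pi g).

Definition sg (v : V) : V := cproj quot_image (sigma (cval v)).

Lemma cj_emb g x : nset H x -> cj g (emb x) = emb (x ^ g).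
Proof.
move=> Hx; rewrite /cj embK// /emb; congr cproj.
by rewrite /conjg !piM (gmorphV piM).
Qed.

Lemma sg_emb x : nset H x -> sg (emb x) = emb (sigma x).
Proof. by move=> Hx; rewrite /sg embK// [sigma _]quot_sigmaE. Qed.

Lemma cjD g : {morph cj g : u v / (u + v)%R}.
Proof.
have [H1 HM HV] := sH.
move=> u v; have [x Hx <-] := emb_onto u; have [y Hy <-] := emb_onto v.
have [Hxg Hyg Hxy] := And3 (HJ g Hx) (HJ g Hy) (HM _ _ Hx Hy).
by rewrite -embM// !cj_emb// conjMg embM.
Qed.

Lemma cjN g : {morph cj g : u / (- u)%R}.
Proof.
have [H1 HM HV] := sH.
move=> u; have [x Hx <-] := emb_onto u.
have [Hxg HVx] := conj (HJ g Hx) (HV _ Hx).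
by rewrite -embV// !cj_emb// conjVg embV.
Qed.

Lemma sgD : {morph sg : u v / (u + v)%R}.
Proof.
have [H1 HM HV] := sH.
move=> u v; have [x Hx <-] := emb_onto u; have [y Hy <-] := emb_onto v.
have [Hsx Hsy Hxy] := And3 (nset_sigma Hx) (nset_sigma Hy) (HM _ _ Hx Hy).
by rewrite -embM// !sg_emb// sigmaM embM.
Qed.

Lemma cjM g g' v : cj (g * g') v = cj g' (cj g v).
Proof.
have [x Hx <-] := emb_onto v.
by rewrite !cj_emb ?conjgM//; exact: HJ.
Qed.

Lemma cj_id g v : nset H g -> cj g v = v.
Proof.
move=> Hg; have [x Hx <-] := emb_onto v; rewrite cj_emb//.
apply/emb_eqP => //; first exact: HJ.
case: HN => _ _ _ NR; have := NR _ _ Hg Hx.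
have -> : [~ g, x] = (x ^ g)^-1 * x.
  by rewrite /commg /conjg !invgM invgK !mulgA.
by apply.
Qed.

Lemma sgcj g v : sg (cj g v) = cj (sigma g) (sg v).
Proof.
have [x Hx <-] := emb_onto v.
rewrite cj_emb// !sg_emb//; last exact: HJ.
rewrite cj_emb; last exact: nset_sigma.
by rewrite /conjg !sigmaM sigmaV.
Qed.

Lemma sgK : involutive sg.
Proof.
move=> v; have [x Hx <-] := emb_onto v.
by rewrite !sg_emb ?sigmaK//; exact: nset_sigma.
Qed.

Variables (gT : finGroupType) (X : {group gT}) (f : G -> gT).
Hypotheses (fX : pquot p X f) (fH : f @^-1` [set 1] = nset H).

Let fM : {morph f : x y / x * y}. Proof. by case: fX. Qed.
Let fin x : f x \in X. Proof. by case: fX. Qed.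

Let fHP x y : f x = f y <-> nset H (x^-1 * y).
Proof.
rewrite -fH /= (pquotMV fX); split=> [->|/mulg1_eq]; first by rewrite mulVg.
by rewrite invgK.
Qed.

Definition fsec (y : gT) : G := xget 1 [set x | f x = y].

Lemma fsecK y : y \in X -> f (fsec y) = y.
Proof.
move=> yX; rewrite /fsec; case: xgetP => [x _ //|].
by case: fX => _ _ /(_ _ yX)[x xE] _ _ /(_ x).
Qed.

Let cocycle_elt (w : G) (y : gT) : G := (fsec (y * f w))^-1 * (fsec y * w).

Let cocycle_eltP w y : y \in X -> nset H (cocycle_elt w y).
Proof.
move=> yX; apply/fHP; rewrite fM !fsecK//.
by rewrite groupM.
Qed.

(* A crossed homomorphism G -> H / H^e [H, H] that multiplies the classes of
   elements of H by the index of H. *)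
Definition transfer (w : G) : V := (\sum_(y in X) emb (cocycle_elt w y))%R.

Lemma transferM w v : transfer (w * v) = (cj v (transfer w) + transfer v)%R.
Proof.
have E y : y \in X -> emb (cocycle_elt (w * v) y) =
    (cj v (emb (cocycle_elt w y)) + emb (cocycle_elt v (y * f w)))%R.
  move=> yX; have yX' : y * f w \in X by rewrite groupM.
  have [Hw Hv] := conj (cocycle_eltP w yX) (cocycle_eltP v yX').
  rewrite cj_emb// addrC -embM//; last exact: HJ.
  congr emb; rewrite /cocycle_elt fM /conjg !mulgA; congr (_ * _).
  by rewrite mulgK mulgK.
rewrite /transfer (eq_bigr _ E) big_split /=; congr (_ + _)%R.
  rewrite (big_morph (cj v) (cjD v) (_ : cj v 0 = 0)%R)//.
  by rewrite -emb1 cj_emb ?conj1g//; case: sH.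
rewrite [RHS](reindex_inj (mulIg (f w))) /=.
by apply: eq_bigl => y; rewrite groupMr.
Qed.

Lemma transfer_sub h : nset H h -> transfer h = (emb h *+ #|X|)%R.
Proof.
move=> Hh; rewrite -sumr_const; apply: eq_bigr => y yX; congr emb.
have fh : f h = 1 by have : (f @^-1` [set 1]) h by rewrite fH.
by rewrite /cocycle_elt fh mulg1 mulKg.
Qed.

(** Adding the [sigma]-conjugate makes the crossed homomorphism equivariant, at the cost of a factor
    2 on [H]. *)
Definition sym_transfer w : V := (transfer w + sg (transfer (sigma w)))%R.

Lemma sym_transferM w v :
  sym_transfer (w * v) = (cj v (sym_transfer w) + sym_transfer v)%R.
Proof.
rewrite /sym_transfer sigmaM !transferM sgD sgcj sigmaK cjD.
by rewrite addrACA.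
Qed.

Lemma sym_transfer_sub h : nset H h ->
  sym_transfer h = (emb h *+ (2 * #|X|))%R.
Proof.
move=> Hh; have Hsh : nset H (sigma h) by exact: nset_sigma.
rewrite /sym_transfer !transfer_sub// mul2n -addnn mulrnDr; congr (_ + _)%R.
rewrite -embX// sg_emb; last exact: subgroupX.
by rewrite (gmorphX _ (@sigmaM G)) sigmaK embX.
Qed.

Lemma sym_transfer_sigma w : sym_transfer (sigma w) = sg (sym_transfer w).
Proof. by rewrite /sym_transfer sgD sgK sigmaK addrC. Qed.

Lemma sym_transferV w : sym_transfer w^-1 = (- cj w^-1%g (sym_transfer w))%R.
Proof.
apply/eqP; rewrite -addr_eq0 addrC -sym_transferM mulgV sym_transfer_sub.
  by rewrite emb1 mul0rn.
by case: sH.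
Qed.

(* As the index #|X| is odd, x^(#|X|./2) is an inverse square root of x modulo
   H; twisting by it turns the relation between the values of the symmetrized
   crossed homomorphism at x and x^-1 into antisymmetry under sigma. *)
Definition minus_gen (x : G) : V := cj (x ^+ #|X|./2) (sym_transfer x).

Lemma minus_genP x : (2 < p)%N -> sigma x = x^-1 ->
  sg (minus_gen x) = (- minus_gen x)%R.
Proof.
move=> p_gt2 sx.
rewrite /minus_gen sgcj -sym_transfer_sigma sx sym_transferV cjN -cjM.
congr (- _)%R; rewrite (gmorphX _ (@sigmaM G)) sx -expgS.
have oX : odd #|X|.
  have [_ _ _ /p_natP[k ->] _] := fX; rewrite oddX; apply/orP; right.
  by case/even_prime: p_prime => // p2; rewrite p2 in p_gt2.
have Hx : nset H (x ^+ #|X|) by rewrite -fH /= (pquot_expg fX) expg_cardG.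
(* The factor [x ^+ #|X|] lies in [H] and acts trivially. *)
have -> : x ^+ #|X|./2 = x^-1 ^+ (#|X|./2).+1 * x ^+ #|X|.
  rewrite -[in x ^+ #|X|](odd_double_half #|X|) oX expVgn add1n -addnn -addSn.
  by rewrite expgnDr mulKg.
by rewrite cjM (cj_id _ Hx).
Qed.

Section Generators.
Variables (n : nat) (x : 'I_n -> G).
Hypothesis xG : [set: G] = cgen (range x).
Hypothesis e0 : (0 < e)%N.
Hypothesis fG : fgen [set: G].

(** All [G]-conjugates of the [a i]; a finite family suffices since [H] acts trivially. Outside [X]
    the section [fsec] takes its default 1 and merely repeats [a i]. *)
Definition orbit_family (a : 'I_n -> V) (t : gT * 'I_n) : V :=
  cj (fsec t.1) (a t.2).

Lemma orbit_familyP a g i : cj g (a i) = orbit_family a (f g, i).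
Proof.
have h : nset H ((fsec (f g))^-1 * g) by apply/fHP; rewrite fsecK.
by rewrite /orbit_family /= -[RHS](cj_id _ h) -cjM mulVKg.
Qed.

Lemma orbit_span_cj a g v : int_span (orbit_family a) v ->
  int_span (orbit_family a) (cj g v).
Proof.
have cj0 : (cj g 0 = 0)%R by rewrite -emb1 cj_emb ?conj1g//; case: sH.
have cjZ u c : (cj g (u *~ c) = cj g u *~ c)%R.
  case: c => k; rewrite ?NegzE ?mulrNz ?cjN -?pmulrn.
    by elim: k => [|k IH]; rewrite ?mulr0n// !mulrS cjD IH.
  by congr (- _)%R; elim: (k.+1) => [|j IH]; rewrite ?mulr0n// !mulrS cjD IH.
move=> [c ->]; rewrite (big_morph (cj g) (cjD g) cj0).
apply: int_span_sum => -[y i]; rewrite cjZ; apply: int_spanZ.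
by rewrite /orbit_family /= -cjM orbit_familyP; exact: int_span_mem.
Qed.

(** The span is stable under conjugation, so the elements at which the cocycle takes values in it
    form a subgroup. It is open, as the cocycle vanishes on [power_comm H e], and it contains the
    generators; so it is [G], and on [H] the cocycle is multiplication by [2 * #|X|]. *)
Lemma minus_gen_span v :
  int_span (orbit_family (fun i => minus_gen (x i))) (v *+ (2 * #|X|))%R.
Proof.
set S := int_span _; have [h Hh <-] := emb_onto v.
rewrite -sym_transfer_sub//.
pose S' := [set w | S (sym_transfer w)].
have SN v' : S v' -> S (- v')%R.
  by move=> Sv; rewrite -mulrN1z; exact: int_spanZ.
have S'1 : S' 1.
  rewrite /S' /= sym_transfer_sub; last by case: sH.
  by rewrite emb1 mul0rn; exact: int_span0.
have sS' : is_subgroup S'.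
  split=> //= [a b Sa Sb|a Sa].
    rewrite /S' /= sym_transferM; apply: int_spanD => //.
    exact: orbit_span_cj.
  by rewrite /S' /= sym_transferV; apply: SN; exact: orbit_span_cj.
have oN : open (power_comm H e) by exact: (power_comm_open proG).
have [N1 _ _] : is_subgroup (power_comm H e) by case: HN.
have oS' : open S'.
  apply: open_subgroup_nbhs => //.
  apply: filterS (open_nbhs_nbhs (conj oN N1)) => z Nz.
  have Hz : nset H z by case: HN => _ _ + _; apply.
  by rewrite /S' /= sym_transfer_sub// emb0// mul0rn; exact: int_span0.
suff : [set: G] `<=` S' by apply.
rewrite xG; apply: cgen_min => //; first exact: open_subgroup_closed.
move=> _ [i _ <-]; rewrite /S' /=.
have -> : sym_transfer (x i) =
    cj (x i ^+ #|X|./2)^-1 (minus_gen (x i)).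
  rewrite /minus_gen -cjM mulgV.
  by rewrite cj_id//; case: sH.
by rewrite (orbit_familyP (fun i => minus_gen (x i))); exact: int_span_mem.
Qed.

Lemma emb_span m (h : 'I_m -> G) : nset H = cgen (range h) ->
  forall v, int_span (fun j => emb (h j)) v.
Proof.
move=> hH v; have [y Hy <-] := emb_onto v.
have [H1 HM HV] := sH.
have Hh j : nset H (h j) by rewrite hH; apply: cgen_sub; exists j.
set S := int_span _; pose S' := [set w | nset H w /\ S (emb w)].
have sS' : is_subgroup S'.
  split=> [|a b [Ha Sa] [Hb Sb]|a [Ha Sa]].
  - by split=> //; rewrite emb1; exact: int_span0.
  - by split; [exact: HM|rewrite embM//; exact: int_spanD].
  - split; [exact: HV|rewrite embV//]; rewrite -mulrN1z; exact: int_spanZ.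
have oN : open (power_comm H e) by exact: (power_comm_open proG).
have [N1 _ _] : is_subgroup (power_comm H e) by case: HN.
have oS' : open S'.
  apply: open_subgroup_nbhs => //.
  apply: filterS (open_nbhs_nbhs (conj oN N1)) => z Nz.
  split; first by case: HN => _ _ + _; apply.
  by rewrite emb0//; exact: int_span0.
suff [] : S' y by [].
move: y Hy; rewrite hH; apply: cgen_min => //; first exact: open_subgroup_closed.
by move=> _ [j _ <-]; split=> //; exact: int_span_mem.
Qed.

End Generators.

End Level.

(** The pairs [(k, b)] with [P (shift k b)] are counted by [k], each shift being a bijection of [S],
    and by [b]. *)
Lemma double_counting (S : finType) K m (shift : 'I_K -> S -> S) (P : pred S) :
  (forall k, injective (shift k)) ->
  (forall b, (#|[pred k | P (shift k b)]| <= m)%N) ->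
  (K * #|P| <= m * #|S|)%N.
Proof.
move=> sinj Pm.
have -> : (K * #|P|)%N = (\sum_(k < K) \sum_(b : S) P (shift k b))%N.
  transitivity (\sum_(k < K) #|P|)%N; first by rewrite sum_nat_const card_ord.
  apply: eq_bigr => k _.
  rewrite -sum1_card (reindex_inj (sinj k)) big_mkcond /=.
  by apply: eq_bigr => b _; rewrite unfold_in; case: (P _).
rewrite exchange_big /=; apply: (@leq_trans (\sum_(b : S) m)); last first.
  by rewrite sum_nat_const mulnC.
apply: leq_sum => b _.
apply: leq_trans (Pm b); rewrite -sum1_card [leqRHS]big_mkcond /=.
by apply: leq_sum => k _; rewrite unfold_in; case: (P _).
Qed.

(** * Counting bad tuples in a finite quotient *)

Section BadCells.
Local Open Scope group_scope.
Import GRing.Theory.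
Variables (p : nat) (p_prime : prime p) (p_gt2 : (2 < p)%N).
Variables (G : sigmaGroupType) (proG : pro_group p G).
Variables (n : nat) (x : 'I_n -> G).
Hypothesis xG : [set: G] = cgen (range x).
Hypothesis xsigma : forall i, sigma (x i) = (x i)^-1.

Let fG : fgen [set: G]. Proof. exact: cgen_range_fgen xG. Qed.
Let cG : compact [set: G]. Proof. by case: proG. Qed.

Lemma fgen_range (H : set G) : fgen H ->
  exists m (h : 'I_m -> G), H = cgen (range h).
Proof.
move=> [s ->]; exists (size s), (tnth (in_tuple s)); congr cgen.
apply/seteqP; split=> y /=; last by move=> [i _ <-]; exact: mem_tnth.
by move=> /(@tnthP _ _ (in_tuple s))[i ->]; exists i.
Qed.

Lemma quot_finite (N : sigmaNormal G) : open (nset N) ->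
  finite_set [set: quot N].
Proof.
move=> oN; have [sN _] := nset_normal N.
have [s _ sP] := open_fin_idx cG sN oN.
apply: (@sub_finite_set _ _ (quot_pi N @` [set` s])); last exact: finite_image.
move=> u _; have [t ts tu] := sP (generic_quotient.repr u) I.
by exists t => //; rewrite -[RHS]quot_reprK; apply/quot_piP.
Qed.

(** When the [r i] lie in [H], the quotient of [H] by this subgroup is the abelianization of the
    image of [H] in the group with relators [r]. *)
Definition relator_comm (H : set G) (r : 'I_n -> G) : set G :=
  cgen ([set z | exists i g, z = r i ^ g] `|`
        [set z | exists a b, [/\ H a, H b & z = [~ a, b]]]).

Variables (H : sigmaNormal G) (oH : open (nset H)).

Let sH : is_subgroup H. Proof. by case: (nset_normal H). Qed.
Let HJ y g : nset H y -> nset H (y ^ g).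
Proof. by case: (nset_normal H) => _; apply. Qed.
Let cH : closed H. Proof. exact: open_subgroup_closed. Qed.

Lemma abelian_section_relator_comm (r : 'I_n -> G) : (forall i, nset H (r i)) ->
  abelian_section H (relator_comm H r).
Proof.
move=> Hr; split=> //; first exact: cgen_subgroup.
  apply: cgen_min => // z [[i [g ->]]|[a [b [Ha Hb ->]]]]; first exact: HJ.
  exact: subgroupR.
by move=> a b Ha Hb; apply: cgen_sub; right; exists a, b.
Qed.

Section Level.
Variables (s : nat) (gT : finGroupType) (X : {group gT}) (f : G -> gT).
Hypotheses (fX : pquot p X f) (fH : f @^-1` [set 1] = nset H).

Let V := comm_zmod (quot_image oH (p ^ s)).
Let pn : (0 < p ^ s)%N. Proof. by rewrite expn_gt0 prime_gt0. Qed.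
Let u (i : 'I_n) : V := minus_gen oH (p ^ s) X f (x i).

Definition good_vector (a : 'I_n -> V) := forall v,
  int_span (orbit_family f a) (v *+ (p ^ s.-1)%N)%R.

Lemma card_bad_shifts m (h : 'I_m -> G) K (a : 'I_n -> V) :
  nset H = cgen (range h) -> ((2 * #|X| * K`!) ^ m < p ^ s)%N ->
  (#|[pred k : 'I_K |
       ~~ `[< good_vector (fun i => a i + u i *+ k)%R >]]| <= m)%N.
Proof.
move=> hH lt_s; have e0 : (0 < 2 * #|X|)%N by rewrite muln_gt0 cardG_gt0.
have torsion (v : V) : (v *+ (p ^ s)%N = 0)%R.
  have [y Hy <-] := emb_onto v; rewrite -embX// emb0//.
  by apply: cgen_sub; left; exists y.
have := @card_bad_pencil V (gT * 'I_n)%type m (fun j => emb oH (p ^ s) (h j))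
  p (2 * #|X|) s K (orbit_family f a) (orbit_family f u) p_prime e0 lt_s
  (emb_span proG pn fG hH) torsion (minus_gen_span proG fX fH xG pn fG).
apply: leq_trans; apply: subset_leq_card; apply/fintype.subsetP => k.
rewrite !inE; apply: contra => /asboolP hk; apply/asboolP => v.
suff -> : orbit_family f (fun i => a i + u i *+ k)%R =
    (fun t => orbit_family f a t + orbit_family f u t *+ k)%R by exact: hk.
apply/funext => -[y i]; rewrite /orbit_family /= cjD; congr (_ + _)%R.
elim: (k : nat) => [|j IH]; last by rewrite !mulrS cjD IH.
by rewrite !mulr0n -(emb1 oH) cj_emb ?conj1g//; case: sH.
Qed.

(** Conjugates of the relators lie in [relator_comm H r], so goodness is the hypothesis of
    [section_fin_idx] with [k = s - 1]. *)
Lemma good_vector_fin_idx (r : 'I_n -> G) : (0 < s)%N ->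
  (forall i, nset H (r i)) -> good_vector (fun i => emb oH (p ^ s) (r i)) ->
  fin_idx H (relator_comm H r).
Proof.
move=> s0 Hr good; have HN := abelian_section_relator_comm Hr.
have [_ [N1 NM NV] NH NR] := HN.
apply: (section_fin_idx p_prime proG HN cH (@cgen_closed _ _)
  (open_fgen proG fG sH oH) (k := s.-1)) => y Hy.
have [c cE] := good (emb oH (p ^ s) y).
rewrite prednK//.
pose S := [set v : V | exists2 z, relator_comm H r z & emb oH (p ^ s) z = v].
have S0 : S 0%R by exists 1 => //; exact: emb1.
have SD v w : S v -> S w -> S (v + w)%R.
  move=> [a Na <-] [b Nb <-]; exists (a * b); first exact: NM.
  by rewrite embM//; exact: NH.
have SN v : S v -> S (- v)%R.
  by move=> [a Na <-]; exists a^-1; [exact: NV|rewrite embV//; exact: NH].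
have SMn v k : S v -> S (v *+ k)%R.
  by move=> Sv; elim: k => [|k IH]; rewrite ?mulr0n// mulrS; exact: SD.
have SZ v k : S v -> S (v *~ k)%R.
  move=> Sv; case: k => k; first by rewrite -pmulrn; exact: SMn.
  by rewrite NegzE mulrNz -pmulrn; apply: SN; exact: SMn.
have [z Nz zE] : S (emb oH (p ^ s) y *+ (p ^ s.-1)%N)%R.
  rewrite cE; apply: (big_ind S) => // -[g i] _; apply: SZ.
  rewrite /orbit_family /= cj_emb//; exists (r i ^ fsec f g) => //.
  by apply: cgen_sub; left; exists i, (fsec f g).
exists z => //; apply/(emb_eqP oH); [exact: NH|exact: subgroupX|].
by rewrite zE embX.
Qed.

End Level.

(* The cells [b j] are the bad [n]-tuples of minus elements of the finite group
   [H / H^(p^s) [H, H]], and [d] is the number of its minus elements; the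
   translates of a tuple by multiples [k < K] of the [minus_gen (x i)] contain
   at most [m] bad ones. *)
Lemma bad_cells : exists m, forall K, exists (N : sigmaNormal G) (d : nat)
    (I : finType) (b : I -> 'I_n -> quot N),
  [/\ open (nset N), (d <= #|` fset_set (minus_part (quot N))|)%N,
      forall j i, minus_part (quot N) (b j i), (K * #|I| <= m * d ^ n)%N &
      forall r : 'I_n -> minusT G, (forall i, nset H (set_val (r i))) ->
        ~ fin_idx H (relator_comm H (fun i => set_val (r i))) ->
        exists j, forall i, quot_pi N (set_val (r i)) = b j i].
Proof.
have [m [h hH]] := fgen_range (open_fgen proG fG sH oH).
have [gT [X [f [fX fH]]]] := pquot_open_normal p_prime proG oH (nset_normal H).
(* [m] is a number of generators of [H] and is fixed before [K]; only the modulus [p^s] grows with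
   [K]. *)
exists m => K; pose s := ((2 * #|X| * K`!) ^ m)%N.+1.
have lt_s : ((2 * #|X| * K`!) ^ m < p ^ s)%N.
  by apply: ltn_trans (ltn_expl _ (prime_gt1 p_prime)).
have pn : (0 < p ^ s)%N by rewrite expn_gt0 prime_gt0.
pose N := power_commN H (p ^ s).
have oN : open (nset N) by exact: (power_comm_open proG).
pose V := comm_zmod (quot_image oH (p ^ s)).
pose u (i : 'I_n) : V := minus_gen oH (p ^ s) X f (x i).
have us i : sg (u i) = (- u i)%R.
  exact: (minus_genP p_prime oH (p ^ s) fX fH p_gt2 (xsigma i)).
have finV : finite_set [set: V].
  apply: (@sub_finite_set _ _ (cproj (quot_image oH (p ^ s)) @` setT)).
    by move=> v _; exists (cval v) => //; exact: cvalK.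
  by apply: finite_image; exact: quot_finite.
pose M := fset_set [set v : V | sg v = (- v)%R].
have ME v : (v \in M) = `[< sg v = (- v)%R >].
  rewrite in_fset_set; last exact: sub_finite_set finV.
  by apply/idP/asboolP => /[!inE].
have sg0 : (sg (0 : V) = 0)%R.
  have := sgD (0 : V)%R (0 : V)%R; rewrite addr0.
  by move=> /(congr1 (fun z => z - sg (0 : V)))%R; rewrite subrr addrK.
have shiftP (k : 'I_K) i (v : M) : (val v + u i *+ k)%R \in M.
  have := fsvalP v; rewrite !ME => /asboolP vs; apply/asboolP.
  have sgMn j : sg (u i *+ j)%R = (- (u i *+ j))%R.
    elim: j => [|j IH]; first by rewrite mulr0n oppr0 sg0.
    by rewrite !mulrS sgD IH us opprD.
  by rewrite sgD vs sgMn opprD.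
pose shift (k : 'I_K) (b : {ffun 'I_n -> M}) : {ffun 'I_n -> M} :=
  [ffun i => [` shiftP k i (b i)]%fset].
pose bad (b : {ffun 'I_n -> M}) := ~~ `[< good_vector f (fun i => val (b i)) >].
have Mminus v : v \in M -> minus_part (quot N) (cval v).
  rewrite ME => /asboolP; have [y Hy <-] := emb_onto v.
  have [Hsy HVy] : nset H (sigma y) /\ nset H y^-1.
    by split; [exact: nset_sigma|case: sH => _ _; apply].
  rewrite sg_emb// -embV// => /(congr1 (@cval _ _)); rewrite !embK// => E.
  rewrite /minus_part /= -(gmorphV (@quot_piM _ _)) -E; exact: quot_sigmaE.
(* [d] counts only the minus elements in the image of [H], while the Haar measure refers to those of
   the whole quotient; hence an inequality for [d]. *)
exists N, #|` M|, {b | bad b},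
  (fun (j : {b | bad b}) i => cval (fsval (sval j i))); split=> //.
- pose W := fset_set (minus_part (quot N)).
  have finW : finite_set (minus_part (quot N)).
    by apply: (@sub_finite_set _ _ setT) => //; exact: quot_finite.
  have <- : #|` [fset cval v | v in M]%fset| = #|` M|.
    by apply: card_imfset; exact: cval_inj.
  apply: fsubset_leq_card; apply/fsubsetP => _ /imfsetP[v /= vM ->].
  by rewrite in_fset_set// inE; exact: Mminus.
- by move=> j i; apply: Mminus; exact: fsvalP.
- rewrite card_sig; have -> : (#|` M| ^ n)%N = #|{ffun 'I_n -> M}|.
    by rewrite card_ffun card_ord cardfE.
  apply: (double_counting (shift := shift)).
    move=> k b b' /ffunP bb'; apply/ffunP => i; have := bb' i.
    by rewrite !ffunE => /(congr1 val)/= /addIr/val_inj.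
  move=> b; apply: leq_trans (card_bad_shifts fX fH (fun i => val (b i)) hH lt_s).
  apply: subset_leq_card; apply/fintype.subsetP => k; rewrite !inE.
  apply: contra => /asboolP g; apply/asboolP.
  by move: g; congr (good_vector _ _); apply/funext => i; rewrite ffunE.
move=> r Hr nfin.
have rM i : emb oH (p ^ s) (set_val (r i)) \in M.
  rewrite ME; apply/asboolP; rewrite sg_emb// -embV//; congr emb.
  exact: (set_valP (r i)).
pose b : {ffun 'I_n -> M} := [ffun i => [` rM i]%fset].
have bb : bad b.
  apply/asboolPn => g; apply: nfin; apply: (@good_vector_fin_idx s _ f) => //.
  by move: g; congr (good_vector _ _); apply/funext => i; rewrite ffunE.
by exists (exist _ b bb) => i /=; rewrite ffunE /= embK.
Qed.
End BadCells.

(** * Measure of the strong classes *)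

Section ZassenhausQuotients.
Local Open Scope group_scope.
Variable p : nat.

(** [D_j] of [K / D_j(K)] is trivial, so [f] kills [D_j(G)]. *)
Lemma zquot_lift (G K : sigmaGroupType) j (f : G -> zquot p K j) :
  sigma_hom f -> exists2 g : zquot p G j -> zquot p K j, sigma_hom g &
    forall x, g (quot_pi (zassenhausN p G j) x) = f x.
Proof.
move=> fh; have fD x : nset (zassenhausN p G j) x -> f x = 1.
  move=> Dx; have [fc fM _] := fh.
  have [y Dy <-] := zquot_zassenhaus (leqnn j) (zassenhaus_morph fc fM Dx).
  apply/quot_piP; rewrite mulg1.
  by have [_ _] := zassenhaus_subgroup p K j; apply.
exists (quot_lift f); first exact: quot_lift_hom.
by move=> x; exact: quot_liftE.
Qed.

Lemma zquot_hom_id (G : sigmaGroupType) j (g : zquot p G j -> zquot p G j) :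
  (forall x, g (quot_pi (zassenhausN p G j) x) = quot_pi (zassenhausN p G j) x) ->
  forall u, g u = u.
Proof. by move=> gE; elim/quot_ind. Qed.

Section Presented.
Variables (n : nat) (F : freeSigmaPro p n) (j : nat).
Implicit Types r : n.-tuple (minusT F).

(** Modulo [D_j] each relator in [r] equals one in [r'], hence dies in the quotient of the second
    group. This local constancy in the relators is what measurability rests on. *)
Lemma presented_zquot_hom r r' :
  (forall i, zassenhaus p F j ((set_val (tnth r' i))^-1 * set_val (tnth r i))) ->
  exists2 f : zquot p (presented r) j -> zquot p (presented r') j,
    sigma_hom f & forall x : F,
    f (quot_pi (zassenhausN p (presented r) j) (quot_pi (relatorsN r) x)) =
    quot_pi (zassenhausN p (presented r') j) (quot_pi (relatorsN r') x).
Proof.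
move=> rr'.
pose q' := quot_pi (relatorsN r').
pose pi' := quot_pi (zassenhausN p (presented r') j).
have q'h : sigma_hom q' by exact: quot_pi_hom.
have [q'c q'M _] := q'h.
have hh : sigma_hom (pi' \o q').
  by apply: sigma_hom_comp => //; exact: quot_pi_hom.
have [D1 DM DV] := zassenhaus_subgroup p (presented r') j.
have hr x : nset (relatorsN r) x -> (pi' \o q') x = 1.
  move=> rx; suff : relators r `<=` q' @^-1` zassenhaus p (presented r') j.
    by move=> /(_ _ rx) Dx; apply/quot_piP; rewrite mulg1; exact: DV.
  apply: cgen_min.
  - by apply: preimage_closed => //; exact: zassenhaus_closed.
  - exact: preimage_subgroup.
  move=> _ [i [g ->]] /=.
  have -> : q' (set_val (tnth r i) ^ g) = q' (set_val (tnth r i)) ^ q' g.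
    by rewrite /conjg !q'M (gmorphV q'M).
  apply: zassenhaus_conj; rewrite -(mulVKg (set_val (tnth r' i)) (set_val _)) q'M.
  have -> : q' (set_val (tnth r' i)) = 1.
    apply/quot_piP; rewrite mulg1.
    have [_ _ RV] : is_subgroup (relators r') by exact: cgen_subgroup.
    by apply: RV; apply: cgen_sub; exists i, 1; rewrite conjg1.
  by rewrite mul1g; exact: (zassenhaus_morph q'c q'M).
have [f fh fE] := zquot_lift (quot_lift_hom hh hr).
by exists f => // x; rewrite fE quot_liftE.
Qed.

Lemma presented_zquot_iso r r' :
  (forall i, zassenhaus p F j ((set_val (tnth r i))^-1 * set_val (tnth r' i))) ->
  sigma_iso (zquot p (presented r) j) (zquot p (presented r') j).
Proof.
move=> rr'.
have [|f fh fE] := @presented_zquot_hom r r'.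
  by move=> i; exact: (subgroup_mulVr (zassenhaus_subgroup p F j)).
have [g gh gE] := @presented_zquot_hom r' r rr'.
exists f, g; split=> // u.
  apply: (@zquot_hom_id _ _ (g \o f)); elim/quot_ind => x /=.
  by rewrite fE gE.
apply: (@zquot_hom_id _ _ (f \o g)); elim/quot_ind => x /=.
by rewrite gE fE.
Qed.

End Presented.

Lemma schur_class_iso (F : forall n, freeSigmaPro p n) n
    (r : n.-tuple (minusT (F n))) :
  sigma_iso (presented r) (schur_group (schur_class r)).
Proof.
rewrite /schur_group; set c := schur_class r.
have : (Tagged (fun n => n.-tuple (minusT (F n))) r
    = generic_quotient.repr c %[mod Sch F])%qT.
  by rewrite reprK.
by move=> /eqmodP/asboolP.
Qed.

End ZassenhausQuotients.

(** * Estimates for product measures *)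

Section Measure.
Import Order.TTheory GRing.Theory Num.Theory.
Local Open Scope ring_scope.
Local Open Scope ereal_scope.
Context (R : realType).

Lemma measurable_tuple_box d (T : measurableType d) n (A : 'I_n -> set T) :
  (forall i, measurable (A i)) ->
  measurable [set t : n.-tuple T | forall i, A i (tnth t i)].
Proof.
move=> mA; rewrite (_ : [set _ | _] =
    \bigcap_(i in [set: 'I_n]) ((@tnth n T)^~ i @^-1` A i)); last first.
  by apply/seteqP; split=> t /= h i; [move=> _; exact: h|exact: (h i I)].
apply: fin_bigcap_measurable => [|i _]; first exact: finite_finset.
by rewrite -[X in measurable X]setTI; exact: measurable_tnth.
Qed.

Lemma power_probability_box d (T : measurableType d) (P : probability T R) n
    (A : 'I_n -> set T) : (forall i, measurable (A i)) ->
  power_probability P n [set t | forall i, A i (tnth t i)] = \prod_(i < n) P (A i).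
Proof.
elim: n A => [|n IH] A mA.
  by rewrite big_ord0 /= diracE mem_set//; case.
rewrite big_ord_recl -(IH (fun i => A (lift ord0 i)))//=.
rewrite -product_measure1E//; last first.
  exact: (measurable_tuple_box (A := fun i => A (lift ord0 i))).
rewrite /distribution /pushforward; congr (_ _).
apply/seteqP; split=> -[a t] /=.
  move=> h; split=> [|i]; first exact: (h ord0).
  by have := h (lift ord0 i); rewrite (tnth_nth a) (tnth_nth a).
move=> [Aa At] i; have [j ->|->] := unliftP ord0 i; last exact: Aa.
by have := At j; rewrite !(tnth_nth a).
Qed.

Lemma measure_seqU_le d (T : measurableType d) (P : probability T R)
    (I : eqType) (s : seq I) (C : I -> set T) (q : R) :
  (forall j, measurable (C j)) -> (forall j, P (C j) = q%:E) ->
  measurable [set t | exists2 j, j \in s & C j t] /\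
  P [set t | exists2 j, j \in s & C j t] <= ((size s)%:R * q)%:E.
Proof.
move=> mC PC; elim: s => [|j s [mS PS]].
  rewrite (_ : [set _ | _] = set0); last by apply/seteqP; split=> // t [].
  by rewrite measure0 mul0r; split.
rewrite (_ : [set _ | _] = C j `|` [set t | exists2 j, j \in s & C j t]).
  split; first exact: measurableU.
  apply: (le_trans (measureU2 P (mC j) mS)).
  by rewrite /= mulrS mulrDl mul1r EFinD PC leeD2l.
apply/seteqP; split=> t /=.
  move=> [k]; rewrite inE => /predU1P[->|ks] Ck; first by left.
  by right; exists k.
move=> [Cj|[k ks Ck]]; first by exists j; rewrite // mem_head.
by exists k; rewrite // inE ks orbT.
Qed.

Lemma negligible_small d (T : measurableType d) (P : probability T R)
    (A : set T) (m : nat) :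
  (forall K : nat, exists B, [/\ measurable B, A `<=` B &
     P B <= (m%:R / K.+1%:R)%:E]) -> P.-negligible A.
Proof.
move=> /choice[B BP]; exists (\bigcap_K B K).
have mB : measurable (\bigcap_K B K).
  by apply: bigcapT_measurable => K; case: (BP K).
split=> //; last by move=> t At K _; case: (BP K) => _ + _; apply.
have PB K : P (\bigcap_K B K) <= (m%:R / K.+1%:R)%:E.
  have [mK _ PK] := BP K; apply: le_trans PK.
  by apply: le_measure; rewrite ?inE//; exact: bigcap_inf.
have fin : P (\bigcap_K B K) \is a fin_num by exact: fin_num_measure.
have ge0 : (0 <= fine (P (\bigcap_K B K)))%R by exact: fine_ge0.
rewrite -(fineK fin); congr (_%:E); apply/eqP; rewrite eq_le ge0 andbT.
rewrite leNgt; apply/negP => gt0.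
set x := fine _ in ge0 gt0.
have := PB (Num.bound (m%:R / x)); rewrite -(fineK fin) lee_fin -/x.
rewrite ler_pdivlMr// => h.
have := archi_boundP (divr_ge0 (ler0n R m) ge0).
rewrite ltr_pdivrMr// mulrC => h'.
by have := le_lt_trans h h'; rewrite ltr_pM2l// ltr_nat ltnNge leqnSn.
Qed.

End Measure.

(** * Null sets of relator tuples *)

Section NullSets.
Import Order.TTheory GRing.Theory Num.Theory.
Local Open Scope group_scope.
Context (R : realType) (p : nat) (p_prime : prime p) (p_gt2 : (2 < p)%N).
Variables (n : nat) (F : freeSigmaPro p n).
Variable haar : probability (borel (minusT F)) R.
Hypothesis haarP : is_haar haar.

Let proF : pro_group p F := free_pro F.
Let cF : compact [set: F]. Proof. by case: proF. Qed.
Let fF : fgen [set: F] := free_fgen p_prime F.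
Let T := borel (minusT F).
Let P := power_probability haar n.

Lemma minus_preimage_measurable (U : set F) : open U ->
  measurable ((fun x : minusT F => set_val x) @^-1` U : set T).
Proof.
move=> oU; apply: sub_sigma_algebra.
by apply: open_comp => // x _; exact: initial_continuous.
Qed.

Lemma minus_box_measurable (U : 'I_n -> set F) : (forall i, open (U i)) ->
  measurable [set t : n.-tuple T | forall i, U i (set_val (tnth t i : minusT F))].
Proof.
move=> oU; apply: (@measurable_tuple_box _ T n
  (fun i => (fun x : minusT F => set_val x) @^-1` U i)) => i.
exact: minus_preimage_measurable.
Qed.

(** Openness of [E] alone does not give measurability for the product sigma-algebra on tuples. [E]
    is a union of boxes cut out by cosets of some [D_j], and there are only countably many of
    these. *)
Lemma locally_determined_measurable (E : set (n.-tuple T)) :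
  (forall t : n.-tuple (minusT F), E t -> exists j, forall t' : n.-tuple (minusT F),
    (forall i, zassenhaus p F j ((set_val (tnth t i))^-1 * set_val (tnth t' i))) ->
    E t') -> measurable E.
Proof.
move=> locE.
have oD j : open (zassenhaus p F j) by exact: zassenhaus_open.
have /choice[s sP] (j : nat) : exists s : seq F,
    forall x : F, exists2 t, t \in s & zassenhaus p F j (t^-1 * x).
  have [s _ sP] := open_fin_idx cF (zassenhaus_subgroup p F j) (oD j).
  by exists s => x; exact: sP.
(* Indices beyond the list fall back to the coset of 1, which is still a legitimate box. *)
pose C (jk : nat * n.-tuple nat) := [set t : n.-tuple T | forall i,
  zassenhaus p F jk.1 ((nth 1 (s jk.1) (tnth jk.2 i))^-1 *
    set_val (tnth t i : minusT F))].
rewrite (_ : E = \bigcup_jk (if `[< C jk `<=` E >] then C jk else set0)).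
  apply: countable_bigcupT_measurable => // jk.
  case: ifP => // _; apply: (@minus_box_measurable (fun i =>
    [set x | zassenhaus p F jk.1 ((nth 1 (s jk.1) (tnth jk.2 i))^-1 * x)])) => i.
  exact: open_lcoset.
apply/seteqP; split=> t.
  move=> Et; have [j jP] := locE t Et.
  have sD := zassenhaus_subgroup p F j.
  have /choice[c cP] (i : 'I_n) : exists c : nat, zassenhaus p F j
      ((nth 1 (s j) c)^-1 * set_val (tnth t i : minusT F)).
    have [y ys Dy] := sP j (set_val (tnth t i : minusT F)).
    by exists (index y (s j)); rewrite nth_index.
  have Ct : C (j, [tuple c i | i < n]) t by move=> i /=; rewrite tnth_mktuple.
  exists (j, [tuple c i | i < n]) => //; rewrite asboolT// => t' Ct'.
  apply: jP => i; apply: (subgroup_mulVtrans sD _ (Ct' i)).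
  exact: (subgroup_mulVr sD (Ct i)).
by move=> [jk _]; case: asboolP => // CE; exact: CE.
Qed.

Definition bad_tuples (H : set F) : set (n.-tuple T) :=
  [set t | (forall i, H (set_val (tnth t i : minusT F))) /\
    ~ fin_idx H (relator_comm H (fun i => set_val (tnth t i : minusT F)))].

Lemma bad_tuples_negligible (H : sigmaNormal F) : open (nset H) ->
  P.-negligible (bad_tuples H).
Proof.
move=> oH.
have [m mP] := bad_cells p_prime p_gt2 proF (free_cgen p_prime F)
  (free_sigma F) oH.
apply: (@negligible_small _ _ _ _ _ m) => K.
have [N [d [I [b [oN dW bminus KI cover]]]]] := mP K.+1.
set W := #|` _| in dW.
pose C (j : I) := [set t : n.-tuple T | forall i,
  quot_pi N (set_val (tnth t i : minusT F)) = b j i].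
have fibre u : exists2 U, open U & [set x : F | quot_pi N x = u] = U.
  exists [set x | nset N ((generic_quotient.repr u)^-1 * x)].
    exact: open_lcoset.
  apply/seteqP; split=> x /=.
    by move=> <-; apply/quot_piP; rewrite quot_reprK.
  by move=> /quot_piP <-; rewrite quot_reprK.
have mfib u : measurable ([set x : minusT F | quot_pi N (set_val x) = u] : set T).
  have [U oU UE] := fibre u.
  rewrite (_ : [set _ | _] = (fun x : minusT F => set_val x) @^-1` U).
    exact: minus_preimage_measurable.
  by rewrite -UE.
have mC j : measurable (C j).
  exact: (@measurable_tuple_box _ T n
    (fun i => [set x : minusT F | quot_pi N (set_val x) = b j i])).
have PC j : P (C j) = ((W%:R ^- n)%R)%:E.
  rewrite /P (@power_probability_box _ _ _ haar n
    (fun i => [set x : minusT F | quot_pi N (set_val x) = b j i]))//.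
  rewrite (eq_bigr (fun=> (W%:R^-1)%R%:E)); last first.
    by move=> i _; exact: haarP.
  by rewrite prodEFin prodr_const card_ord exprVn.
have [mU PU] := measure_seqU_le (enum I) mC PC.
exists [set t | exists2 j, j \in enum I & C j t]; split=> //.
  move=> t [Ht nfin]; have [j jP] := cover (fun i => tnth t i) Ht nfin.
  by exists j; rewrite ?mem_enum.
apply: le_trans PU _; rewrite -cardE lee_fin.
have W0 : (0 < W)%N.
  rewrite cardfs_gt0; apply/fset0Pn; exists 1.
  rewrite in_fset_set; last first.
    exact: sub_finite_set (subsetT _) (quot_finite proF oN).
  by rewrite inE; have := minus1 (quot N); rewrite inE.
(* Each of the [#|I|] cells has measure [W^-n], so this inequality bounds their total by
   [m / (K + 1)]. *)
have KW : (K.+1 * #|I| <= m * W ^ n)%N.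
  by apply: leq_trans KI _; rewrite leq_mul2l; apply/orP; right;
    case: (posnP n) => [->|n0]; rewrite ?expn0 ?leq_exp2r.
rewrite ler_pdivlMr ?ltr0n// mulrAC ler_pdivrMr ?exprn_gt0 ?ltr0n//.
by rewrite -natrX -!natrM ler_nat mulnC.
Qed.

(** The preimage [H] of [D_i(G_r)] is a union of cosets of [D_i(F)], so it is [U S] for one of
    finitely many [S]. It contains the relators, and [H] modulo [relator_comm] maps onto the
    abelianization of [D_i(G_r)]; so an infinite abelianization makes [r] a bad tuple for [H]. *)
Lemma not_ab_finite_negligible i :
  P.-negligible [set t : n.-tuple T |
    ~ zassenhaus_ab_finite p (presented (t : n.-tuple (minusT F))) i].
Proof.
have sD := zassenhaus_subgroup p F i.
have [s _ sP] := open_fin_idx cF sD (zassenhaus_open p_prime proF fF i).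
pose U (S : seq F) := [set x | exists2 y, y \in S & zassenhaus p F i (y^-1 * x)].
pose B (S : seq F) := [set t : n.-tuple T | exists H : sigmaNormal F,
  [/\ open (nset H), nset H = U S & bad_tuples H t]].
have BN S : P.-negligible (B S).
  have [[H [oH HE]]|nH] := pselect (exists H : sigmaNormal F,
      open (nset H) /\ nset H = U S).
    apply: negligibleS (bad_tuples_negligible oH) => t [H' [_ H'E]].
    by rewrite H'E -HE.
  rewrite (_ : B S = set0); first exact: negligible_set0.
  by apply/seteqP; split=> // t [H [oH HE _]]; apply: nH; exists H.
(* Sublists of [s] are encoded by boolean masks, and these by integers, to fit a union indexed by
   [nat]. *)
pose BB k := if choice.unpickle k is Some m then B (mask m s) else set0.
have BBN : P.-negligible (\bigcup_k BB k).
  apply: negligible_bigcup => k; rewrite /BB.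
  by case: (choice.unpickle k) => [m|]; [exact: BN|exact: negligible_set0].
apply: negligibleS BBN.
move=> t nab; set r : n.-tuple (minusT F) := t in nab.
pose q := quot_pi (relatorsN r).
have qc : continuous q by exact: quot_pi_continuous.
have qM : {morph q : x y / x * y} by exact: quot_piM.
have qT : q @` [set: F] = [set: presented r].
  apply/seteqP; split=> // u _; exists (generic_quotient.repr u) => //.
  exact: quot_reprK.
have [_ hG _] := presented_pro p_prime r.
pose D := zassenhaus p (presented r) i.
have HN : is_normal (q @^-1` D).
  split; first by apply: preimage_subgroup => //; exact: zassenhaus_subgroup.
  move=> x g /= Dx; have := zassenhaus_conj (q g) Dx.
  by rewrite /conjg !qM (gmorphV qM).
have Hs x : (q @^-1` D) x -> (q @^-1` D) (sigma x).
  move=> Dx; have := zassenhaus_sigma Dx.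
  by rewrite [sigma _]quot_sigmaE.
pose H := SigmaNormal HN Hs.
have DH : zassenhaus p F i `<=` nset H by move=> x; exact: zassenhaus_morph.
have [H1 HM HV] : is_subgroup (nset H) by case: (HN).
have oH : open (nset H).
  apply: open_subgroup_nbhs => //; apply: filterS DH _.
  apply: open_nbhs_nbhs; split; first exact: zassenhaus_open.
  by case: sD.
have qH : q @` nset H = D.
  apply/seteqP; split=> [_ [x Dx <-]//|u Du].
  by have : [set: presented r] u by []; rewrite -qT => -[x _ xu]; exists x;
    rewrite //= xu.
have HU : nset H = U [seq y <- s | `[< nset H y >]].
  apply/seteqP; split=> x.
    move=> Hx; have [y ys Dy] := sP x I; exists y => //.
    rewrite mem_filter ys andbT; apply/asboolP.
    have := HM _ _ Hx (HV _ (DH _ Dy)).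
    by rewrite invgM invgK mulVKg.
  move=> [y]; rewrite mem_filter => /andP[/asboolP Hy _] /DH Hyx.
  by rewrite -(mulVKg y x); exact: HM.
exists (choice.pickle [seq `[< nset H y >] | y <- s]) => //.
rewrite /BB choice.pickleK -filter_mask; exists H; split=> //; split=> [j|fin].
  rewrite /= (_ : q _ = 1); first by case: (zassenhaus_subgroup p (presented r) i).
  apply/quot_piP; rewrite mulg1.
  have [_ _ RV] : is_subgroup (relators r) by exact: cgen_subgroup.
  by apply: RV; apply: cgen_sub; exists j, 1; rewrite conjg1.
apply: nab; rewrite /zassenhaus_ab_finite -/D -qH.
apply: fin_idxS (fin_idx_image qM fin).
rewrite /relator_comm (cgen_image qc qM cF hG); apply: cgen_min.
- exact: cgen_closed.
- exact: cgen_subgroup.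
move=> _ [z [[j [g ->]]|[a [b [Ha Hb ->]]]] <-].
  have [N1 _ _] : is_subgroup (comm_subgroup (q @` nset H) (q @` nset H)).
    exact: cgen_subgroup.
  rewrite (_ : q _ = 1)//; apply/quot_piP; rewrite mulg1.
  have [_ _ RV] : is_subgroup (relators r) by exact: cgen_subgroup.
  by apply: RV; apply: cgen_sub; exists j, g.
apply: cgen_sub; exists (q a), (q b); split; [by exists a|by exists b|].
exact: (gmorphR qM).
Qed.

End NullSets.

Section Main.
Import Order.TTheory GRing.Theory Num.Theory.
Local Open Scope ereal_scope.
Context (R : realType) (p : nat) (p_prime : prime p) (p_gt2 : (2 < p)%N).
Variable F : forall n, freeSigmaPro p n.
Variable haar : forall n, probability (borel (minusT (F n))) R.
Hypothesis haarP : forall n, is_haar (haar n).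

(** [schur_group] takes an arbitrary representative of the class, possibly with another number of
    generators; the condition is carried along the isomorphism. *)
Lemma schur_ab_finiteE n (r : n.-tuple (minusT (F n))) i :
  zassenhaus_ab_finite p (schur_group (schur_class r)) i <->
  zassenhaus_ab_finite p (presented r) i.
Proof.
have proS := schur_group_pro p_prime (schur_class r).
have proG := presented_pro p_prime r; have iso := schur_class_iso r.
split; first exact: (zassenhaus_ab_finite_iso proS proG (sigma_iso_sym iso)).
exact: zassenhaus_ab_finite_iso.
Qed.

Lemma mu_fin_strong n : mu_fin haar n (Sch_strong F) = 1.
Proof.
pose T := borel (minusT (F n)); pose P := power_probability (haar n) n.
pose E i := [set t : n.-tuple T |
  zassenhaus_ab_finite p (presented (t : n.-tuple (minusT (F n)))) i].
have mE i : measurable (E i).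
  apply: (locally_determined_measurable p_prime) => t Et.
  have [j j2 jP] := zassenhaus_ab_finite_locally p_prime (F n)
    (presented_pro p_prime t) (presented_cgen p_prime t) Et.
  exists j => t' tt'; apply: jP; first exact: presented_pro.
  by apply: sigma_iso_sym; exact: presented_zquot_iso.
have -> : mu_fin haar n (Sch_strong F) = P (\bigcap_i E i).
  rewrite /mu_fin; congr (power_probability _ _ _).
  rewrite (Sch_strongE p_prime); apply/seteqP; split=> t h i _.
    by apply/schur_ab_finiteE; exact: h.
  by apply/schur_ab_finiteE; exact: h.
have mEE : measurable (\bigcap_i E i) by exact: bigcapT_measurable.
have : P (~` \bigcap_i E i) = 0.
  apply: measure_negligible; first exact: measurableC.
  rewrite setC_bigcap; apply: negligible_bigcup => i.
  exact: not_ab_finite_negligible.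
rewrite probability_setC// => /eqP; rewrite sube_eq ?fin_num_measure//.
by rewrite add0e => /eqP ->.
Qed.

End Main.

Theorem theorem11p4 (R : realType) (p : nat) (p_prime : prime p)
    (p_gt2 : (2 < p)%N) (F : forall n : nat, freeSigmaPro p n)
    (haar : forall n : nat, probability (borel (minusT (F n))) R)
    (haarP : forall n : nat, is_haar (haar n)) :
  Gdelta (Sch_strong F) /\ mu_infty haar (Sch_strong F) = 1%E.
Proof.
split; first exact: Sch_strong_Gdelta.
rewrite /mu_infty (_ : (fun n => _) = cst 1%E); last first.
  by apply/funext => n; exact: mu_fin_strong.
exact: lim_cst.
Qed.
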